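(* Suppose that $s\geq\tfrac12$ and $2\leq p<4s+1$. Then the equation $$(-\Delta)^{s}u=\lambda u+|u|^{p},\qquad x\in\mathbb{T},$$ admits at least one non-constant even solution for each $$\lambda\in\bigcup_{k\in\mathbb{N}}\left(k^{2s},(k+1)^{2s}\right).$$
   Context: $\mathbb{T}=\mathbb{R}/2\pi\mathbb{Z}$, $\mathbb{N}=\{1,2,\dots\}$. Functions are real-valued, with Fourier series $u(x)=\sum_{n\in\mathbb{Z}}\widehat u(n)e^{inx}$. For periodic functions, $(-\Delta)^su=\sum_{n\in\mathbb{Z}}|n|^{2s}\widehat u(n)e^{inx}$. $H^{2s}_+(\mathbb{T})$ is the space of even functions $u\in L^2(\mathbb{T})$ with $\sum_n|n|^{4s}|\widehat u(n)|^2<\infty$. An even solution is a function $u\in H^{2s}_+(\mathbb{T})$ satisfying the equation pointwise almost everywhere. *)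

(* Defs.v *)
From mathcomp Require Import all_boot all_order all_algebra.
From mathcomp Require Import complex.
From mathcomp Require Import all_classical all_reals all_analysis.

Set Implicit Arguments.
Unset Strict Implicit.
Unset Printing Implicit Defensive.

Import Order.TTheory GRing.Theory Num.Theory.
Import numFieldNormedType.Exports.

Local Open Scope classical_set_scope.
Local Open Scope ring_scope.
Local Open Scope complex_scope.

(* Functions on the torus R/2piZ are represented by functions R -> R of period
   2 * pi; integrals, L^p classes and "almost everywhere" on the torus are taken
   with respect to the (unnormalized) Lebesgue measure on one period. *)
Definition torus_measure (R : realType) : {measure set (measurableTypeR R) -> \bar R} :=
  mrestr (@lebesgue_measure R) (measurable_itv `[- pi, pi]).

Definition cexpi (R : realType) (t : R) : R[i] := cos t +i* sin t.

(* fourier_coef u n = 1/(2 pi) \int u(x) e^{-inx} dx; the integral of the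
   complex-valued integrand is taken componentwise. *)
Definition fourier_coef (R : realType) (u : R -> R) (n : int) : R[i] :=
  let f (x : R) : R[i] := (u x)%:C * cexpi (- (n%:~R * x)) in
  ((2 * pi)^-1)%:C *
  (Rintegral (torus_measure R) setT (fun x => complex.Re (f x))
   +i* Rintegral (torus_measure R) setT (fun x => complex.Im (f x))).

(* Membership in H^r_+ of a representative that is genuinely periodic and even,
   rather than only up to a null set.  With r = 2s the weight is |n|^{4s}. *)
Definition even_sobolev (R : realType) (r : R) (u : R -> R) : Prop :=
  [/\ periodic u (2 * pi),
      (forall x, u (- x) = u x),
      u \in Lfun (torus_measure R) 2%:E &
      (\esum_(n in [set: int])
         (`|n%:~R| `^ (2 * r) * ComplexField.Normc.normc (fourier_coef u n) ^+ 2)%:E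
       < +oo)%E].

(* \sum_(|n| <= N) |n|^{2s} u^(n) e^{inx}, with the index shifted by N.  For s > 0
   the n = 0 term vanishes, since 0 `^ a = 0 when a != 0. *)
Definition frac_laplacian_psum (R : realType) (s : R) (u : R -> R) (N : nat)
    (x : R) : R[i] :=
  \sum_(k < N.*2.+1)
    let n := (k%:Z - N%:Z)%R in
    (`|n%:~R| `^ (2 * s))%:C * fourier_coef u n * cexpi (n%:~R * x).

(* g represents (-Delta)^s u: g is in L^2 of the torus and is the L^2 sum of the
   Fourier series of (-Delta)^s u. *)
Definition is_frac_laplacian (R : realType) (s : R) (u g : R -> R) : Prop :=
  g \in Lfun (torus_measure R) 2%:E /\
  (\int[torus_measure R]_x
     (ComplexField.Normc.normc (frac_laplacian_psum s u N x - (g x)%:C) ^+ 2)%:E)%E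
    @[N --> \oo] --> 0%E.

Definition even_solution (R : realType) (s p lam : R) (u : R -> R) : Prop :=
  even_sobolev (2 * s) u /\
  exists2 g : R -> R, is_frac_laplacian s u g &
    {ae torus_measure R, forall x, g x = lam * u x + `|u x| `^ p}.

(* Constancy is up to null sets, as for elements of L^2. *)
Definition torus_constant (R : realType) (u : R -> R) : Prop :=
  exists c : R, {ae torus_measure R, forall x, u x = c}.

(* Main.v *)
Require Import Defs.
From mathcomp Require Import all_boot all_order all_algebra.
From mathcomp Require Import complex.
From mathcomp Require Import all_classical all_reals all_analysis.
From mathcomp Require Import measurable_realfun ring lra zify.

Set Implicit Arguments.
Unset Strict Implicit.
Unset Printing Implicit Defensive.

Import Order.TTheory GRing.Theory Num.Theory.
Import numFieldNormedType.Exports.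

Local Open Scope classical_set_scope.
Local Open Scope ring_scope.

(** The equation is the Euler-Lagrange equation of the energy

      E(u) = 1/2 <(-Delta)^s u, u> - \int G(u),
      G(t) = lam t^2 / 2 + |t|^p t / (p + 1),

    on even functions.  The negative constant [-c] with [c ^ (p - 1) = lam] is a
    strict local minimum of [E], and [E] tends to [-oo] along positive constants,
    so there is a mountain pass above [-c].  Its level is negative: one can leave
    the well along the constants up to a small neighbourhood of [0], go round [0]
    in the plane of the modes [1] and [cos x], and continue along the positive
    constants.  Since [1 < lam], the quadratic form of [E] is negative definite
    on that plane, hence [E] is negative on the whole path.  A critical point at
    a level strictly between [E(-c)] and [E(0) = 0] is neither [-c] nor [0], and
    these are the only constant solutions.

    The critical point is obtained by a Galerkin scheme.
    - On cosine polynomials of bounded degree, and for a nonlinearity truncated to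
      linear growth, the gradient of [E] is globally Lipschitz and
      [mountain_pass], a deformation argument with explicit gradient steps,
      applies; the outcome is [galerkin_mountain_pass].
    - [a_priori_bound] bounds the total mass of the coefficients, uniformly in the
      degree and in the truncation.  Testing with constants controls the
      nonlinearity in [L^1], so the coefficients decay harmonically, and
      Bessel's inequality turns this into a bound for the [L^2] norm and then for
      the supremum.  The truncation can therefore be placed above all solutions.
    - The bound also gives compactness in [l^1] ([coefs_compact]), and
      [galerkin_limit] passes to a uniform limit.  The limit is not [0] because
      its energy is negative.  It is not [-c] because no critical point other than
      [-c] lies below [-c / 2], as testing its equation with [u + c] shows.
    - The limit solves the equation in each cosine mode.  To identify the
      [L^2] sum of the Fourier series with the nonlinearity, the latter is
      approximated uniformly by cosine polynomials: it is a Lipschitz function of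
      a uniform limit of cosine polynomials, so Bernstein polynomials suffice
      ([lipschitz_comp_approx]). *)

(** * Integration over one period *)

Section TorusIntegral.
Context {R : realType}.
Implicit Types (f g : R -> R).

(** On this class the integral is a total, monotone linear functional, and the
    class is stable under all operations performed on solutions. *)
Definition bounded_measurable f :=
  measurable_fun [set: R] f /\ exists M, forall x, `|f x| <= M.

Definition torus_int f : R := Rintegral (torus_measure R) setT f.

Let mu := torus_measure R.

Lemma torus_measure_setT : mu setT = (2 * pi)%:E.
Proof.
rewrite /mu /torus_measure /= /mrestr setTI lebesgue_measure_itv /=.
have p0 := @pi_gt0 R.
rewrite lte_fin ifT; last by lra.
by congr EFin; ring.
Qed.

Lemma bm_integrable f : bounded_measurable f -> mu.-integrable setT (EFin \o f).
Proof.
move=> [mf [M bM]]; apply: measurable_bounded_integrable => //=.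
  by rewrite -/mu torus_measure_setT ltry.
exists M; split; first by rewrite num_real.
by move=> r Mr x _ /=; apply: (le_trans (bM x)); apply: ltW.
Qed.

Lemma bm_cst c : bounded_measurable (fun=> c).
Proof. by split; [exact: measurable_cst | exists `|c|]. Qed.

Lemma bm_add f g : bounded_measurable f -> bounded_measurable g ->
  bounded_measurable (fun x => f x + g x).
Proof.
move=> [mf [M bM]] [mg [N bN]]; split; first exact: measurable_funD.
by exists (M + N) => x; rewrite (le_trans (ler_normD _ _))// lerD.
Qed.

Lemma bm_mul f g : bounded_measurable f -> bounded_measurable g ->
  bounded_measurable (fun x => f x * g x).
Proof.
move=> [mf [M bM]] [mg [N bN]]; split; first exact: measurable_funM.
by exists (M * N) => x; rewrite normrM ler_pM.
Qed.

Lemma bm_sqr f : bounded_measurable f -> bounded_measurable (fun x => f x ^+ 2).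
Proof.
move=> bf; have -> : (fun x => f x ^+ 2) = (fun x => f x * f x).
  by apply/funext => x; rewrite expr2.
exact: bm_mul.
Qed.

Lemma bm_scale c f : bounded_measurable f -> bounded_measurable (fun x => c * f x).
Proof. by move=> bf; apply: bm_mul => //; exact: bm_cst. Qed.

Lemma bm_opp f : bounded_measurable f -> bounded_measurable (fun x => - f x).
Proof.
move=> [mf [M bM]]; split; first exact: measurableT_comp.
by exists M => x; rewrite normrN.
Qed.

Lemma bm_sub f g : bounded_measurable f -> bounded_measurable g ->
  bounded_measurable (fun x => f x - g x).
Proof. by move=> bf bg; apply: bm_add => //; exact: bm_opp. Qed.

Lemma bm_norm f : bounded_measurable f -> bounded_measurable (fun x => `|f x|).
Proof.
move=> [mf [M bM]]; split; first exact: measurableT_comp.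
by exists M => x; rewrite normr_id.
Qed.

Lemma bm_sum (I : Type) (r : seq I) (F : I -> R -> R) :
  (forall i, bounded_measurable (F i)) ->
  bounded_measurable (fun x => \sum_(i <- r) F i x).
Proof.
move=> bF; elim: r => [|i r IH].
  by under eq_fun do rewrite big_nil; exact: bm_cst.
by under eq_fun do rewrite big_cons; exact: bm_add.
Qed.

(** Bounded functions stay bounded after composition because a continuous
    function is bounded on a segment. *)
Lemma bm_comp (h : R -> R) f : continuous h -> bounded_measurable f ->
  bounded_measurable (h \o f).
Proof.
move=> ch [mf [M bM]]; split.
  by apply: measurableT_comp => //; exact: continuous_measurable_fun.
have M0 : 0 <= M by apply: le_trans (bM 0).
have cseg : {within `[- M, M], continuous (fun t => `|h t|)}.
  apply: continuous_subspaceT => t; apply: continuous_comp; first exact: ch.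
  exact: norm_continuous.
have [|c _ hc] := EVT_max _ cseg; first by lra.
exists `|h c| => x; apply: hc; rewrite in_itv /= -ler_norml.
exact: bM.
Qed.

Lemma eq_torus_int f g : f =1 g -> torus_int f = torus_int g.
Proof. by move=> /funext ->. Qed.

Lemma torus_int_add f g : bounded_measurable f -> bounded_measurable g ->
  torus_int (fun x => f x + g x) = torus_int f + torus_int g.
Proof. by move=> bf bg; rewrite /torus_int RintegralD//; exact: bm_integrable. Qed.

Lemma torus_int_sub f g : bounded_measurable f -> bounded_measurable g ->
  torus_int (fun x => f x - g x) = torus_int f - torus_int g.
Proof. by move=> bf bg; rewrite /torus_int RintegralB//; exact: bm_integrable. Qed.

Lemma torus_int_scale c f : bounded_measurable f ->
  torus_int (fun x => c * f x) = c * torus_int f.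
Proof. by move=> bf; rewrite /torus_int RintegralZl//; exact: bm_integrable. Qed.

Lemma torus_int_cst c : torus_int (fun=> c) = 2 * pi * c.
Proof. by rewrite /torus_int Rintegral_cst// -/mu torus_measure_setT mulrC. Qed.

Lemma torus_int_le f g : bounded_measurable f -> bounded_measurable g ->
  (forall x, f x <= g x) -> torus_int f <= torus_int g.
Proof.
by move=> bf bg fg; apply: le_Rintegral => //; exact: bm_integrable.
Qed.

Lemma torus_int_ge0 f : (forall x, 0 <= f x) -> 0 <= torus_int f.
Proof. by move=> f0; apply: Rintegral_ge0. Qed.

Lemma torus_int_norm_le f : bounded_measurable f ->
  `|torus_int f| <= torus_int (fun x => `|f x|).
Proof. by move=> bf; apply: le_normr_Rintegral => //; exact: bm_integrable. Qed.

Lemma torus_int_norm_bound f M : bounded_measurable f ->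
  (forall x, `|f x| <= M) -> `|torus_int f| <= 2 * pi * M.
Proof.
move=> bf fM; apply: le_trans (torus_int_norm_le bf) _.
rewrite -torus_int_cst; apply: torus_int_le => //; first exact: bm_norm.
exact: bm_cst.
Qed.

Lemma torus_int_sum (I : Type) (r : seq I) (F : I -> R -> R) :
  (forall i, bounded_measurable (F i)) ->
  torus_int (fun x => \sum_(i <- r) F i x) = \sum_(i <- r) torus_int (F i).
Proof.
move=> bF; elim: r => [|i r IH].
  by under eq_torus_int do rewrite big_nil; rewrite torus_int_cst big_nil mulr0.
under eq_torus_int do rewrite big_cons.
by rewrite big_cons torus_int_add// ?IH//; exact: bm_sum.
Qed.

Lemma torus_int_ae_cst f c (h : R -> R) : bounded_measurable (h \o f) ->
  {ae torus_measure R, forall x, f x = c} ->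
  torus_int (h \o f) = 2 * pi * h c.
Proof.
move=> bhf fc; rewrite -torus_int_cst /torus_int /Rintegral; congr fine.
apply: ae_eq_integral => //.
- by apply/measurable_EFinP; case: bhf.
- by case: fc => A [mA A0 sA]; exists A; split => // x /= nx; apply: sA => /= fxc;
    apply: nx => _; rewrite /= fxc.
Qed.

Lemma torus_int_itv f : bounded_measurable f ->
  torus_int f = fine (\int[lebesgue_measure]_(x in `[(- pi)%R, pi]) (f x)%:E)%E.
Proof.
move=> bf; rewrite /torus_int /Rintegral; congr fine.
have mD : measurable (`[- pi, pi]%classic : set R) by exact: measurable_itv.
(* The restricted measure ignores the complement of the period and agrees with
   Lebesgue measure inside it. *)
rewrite (@negligible_integral _ _ _ (torus_measure R) setT (~` `[- pi, pi]))//; first last.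
- by rewrite /torus_measure /= /mrestr setICl measure0.
- exact: bm_integrable.
- exact: measurableC.
rewrite setTD setCK; apply: (eq_measure_integral lebesgue_measure) => A mA AD.
by rewrite /torus_measure /= /mrestr setIidl.
Qed.

Lemma torus_int_derive (f F : R -> R) : continuous f ->
  (forall x : R, is_derive x 1 F (f x)) -> bounded_measurable f ->
  torus_int f = F pi - F (- pi).
Proof.
move=> cf dF bf; rewrite torus_int_itv//.
have p0 := @pi_gt0 R.
have cF : continuous F.
  by move=> x; apply/differentiable_continuous/derivable1_diffP; have [] := dF x.
rewrite (@continuous_FTC2 _ f F)//.
- by lra.
- exact: continuous_subspaceT.
- split; [by move=> x _; have [] := dF x| |].
    by apply: cvg_at_right_filter; exact: cF.
  by apply: cvg_at_left_filter; exact: cF.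
- by move=> x _; rewrite derive1E; have [_ ->] := dF x.
Qed.

End TorusIntegral.

(** * Cosine polynomials *)

Section CosinePolynomials.
Context {R : realType}.
Implicit Types (a b c : nat -> R) (N n m : nat) (x : R).

Definition cosn n x : R := cos (n%:R * x).

(** The squared norm of [cosn n] in [L^2] of the torus. *)
Definition cosn_mass n : R := if n == 0%N then 2 * pi else pi.

Lemma cosn_mass_ge n : pi <= cosn_mass n.
Proof. by rewrite /cosn_mass; have := @pi_gt0 R; case: ifP; lra. Qed.

Lemma cosn_mass_le n : cosn_mass n <= 2 * pi.
Proof. by rewrite /cosn_mass; have := @pi_gt0 R; case: ifP; lra. Qed.

Lemma cosn_mass_gt0 n : 0 < cosn_mass n.
Proof. exact: lt_le_trans (@pi_gt0 R) (cosn_mass_ge n). Qed.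

Lemma continuous_scaled (f : R -> R) (z : R) : continuous f ->
  continuous (fun x => f (z * x)).
Proof.
move=> cf x; apply: (@continuous_comp _ _ _ ( *%R z) f); last exact: cf.
exact: mulrl_continuous.
Qed.

Lemma bm_cos_scaled (z : R) : bounded_measurable (fun x : R => cos (z * x)).
Proof.
split; first by apply: continuous_measurable_fun; apply: continuous_scaled; exact: continuous_cos.
by exists 1 => x; exact: cos_max.
Qed.

Lemma bm_sin_scaled (z : R) : bounded_measurable (fun x : R => sin (z * x)).
Proof.
split; first by apply: continuous_measurable_fun; apply: continuous_scaled; exact: continuous_sin.
by exists 1 => x; exact: sin_max.
Qed.

Lemma bm_cosn n : bounded_measurable (cosn n).
Proof. exact: bm_cos_scaled. Qed.

Lemma cosn0 x : cosn 0 x = 1.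
Proof. by rewrite /cosn mul0r cos0. Qed.

Lemma normr_cosn_le1 n x : `|cosn n x| <= 1.
Proof. exact: cos_max. Qed.

Lemma cosnN n x : cosn n (- x) = cosn n x.
Proof. by rewrite /cosn mulrN cosN. Qed.

Lemma cosDn2pi n (y : R) : cos (y + n%:R * (2 * pi)) = cos y.
Proof.
elim: n => [|n IH]; first by rewrite mul0r addr0.
by rewrite -IH -[RHS]cosD2pi -natr1; congr cos; ring.
Qed.

Lemma cosn_periodic n x : cosn n (x + 2 * pi) = cosn n x.
Proof. by rewrite /cosn mulrDr cosDn2pi. Qed.

Lemma sinn_pi n : sin (n%:R * pi) = 0 :> R.
Proof.
elim: n => [|n IH]; first by rewrite mul0r sin0.
by rewrite -natr1 mulrDl mul1r sinDpi IH oppr0.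
Qed.

Lemma torus_int_cosn n : torus_int (cosn n) = if n == 0%N then 2 * pi else 0.
Proof.
case: eqP => [->|/eqP n0].
  by under eq_torus_int do rewrite cosn0; rewrite torus_int_cst mulr1.
have nn0 : n%:R != 0 :> R by rewrite pnatr_eq0.
have dF x : is_derive x (1 : R) (fun x => n%:R^-1 * sin (n%:R * x)) (cosn n x).
  apply: is_derive_eq.
  rewrite /cosn /GRing.scale /=.  by field.
rewrite (torus_int_derive _ dF).
- by rewrite mulrN sinN sinn_pi oppr0 mulr0 subrr.
- by apply: continuous_scaled; exact: continuous_cos.
- exact: bm_cosn.
Qed.

Lemma torus_int_sin_scaled (z : R) : torus_int (fun x => sin (z * x)) = 0.
Proof.
have [->|z0] := eqVneq z 0.
  by under eq_torus_int do rewrite mul0r sin0; rewrite torus_int_cst mulr0.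
have dF x : is_derive x (1 : R) (fun x => - (z^-1 * cos (z * x))) (sin (z * x)).
  apply: is_derive_eq.
  rewrite /GRing.scale /=.  by field.
rewrite (torus_int_derive _ dF).
- by rewrite mulrN cosN subrr.
- by apply: continuous_scaled; exact: continuous_sin.
- exact: bm_sin_scaled.
Qed.

Lemma cosnM n m x :
  cosn n x * cosn m x = 2^-1 * (cosn (n + m) x + cosn ((n - m) + (m - n)) x).
Proof.
rewrite /cosn; wlog nm : n m / (m <= n)%N.
  move=> H; case/orP: (leq_total m n) => [/H //|/H].
  by rewrite mulrC addnC [(_ - _ + _)%N]addnC.
have -> : (n - m + (m - n) = n - m)%N.
  by move: (nm); rewrite -subn_eq0 => /eqP ->; rewrite addn0.
by rewrite natrD natrB// mulrDl mulrBl cosD cosB; field.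
Qed.

Lemma cosn_orthogonal n m :
  torus_int (fun x => cosn n x * cosn m x) = if n == m then cosn_mass n else 0.
Proof.
under eq_torus_int do rewrite cosnM.
rewrite torus_int_scale; last by apply: bm_add; exact: bm_cosn.
rewrite torus_int_add; try exact: bm_cosn.
rewrite !torus_int_cosn !addn_eq0 !subn_eq0 -eqn_leq /cosn_mass.
case: (eqVneq n m) => [->|nm]; last first.
  have -> : (n == 0%N) && (m == 0%N) = false.
    by apply/negbTE; apply: contra nm => /andP[/eqP -> /eqP ->].
  by rewrite addr0 mulr0.
by rewrite andbb; case: eqP => _; field.
Qed.

Lemma cosn_sin_orthogonal n m :
  torus_int (fun x => cosn n x * sin (m%:R * x)) = 0.
Proof.
have E x : cosn n x * sin (m%:R * x) =
    2^-1 * (sin ((m%:R + n%:R) * x) + sin ((m%:R - n%:R) * x)).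
  by rewrite /cosn mulrDl mulrBl sinD sinB; field.
under eq_torus_int do rewrite E.
rewrite torus_int_scale; last by apply: bm_add; exact: bm_sin_scaled.
by rewrite torus_int_add ?torus_int_sin_scaled ?addr0 ?mulr0//; exact: bm_sin_scaled.
Qed.

Definition cos_poly N a x : R := \sum_(i < N) a i * cosn i x.

Lemma bm_cos_poly N a : bounded_measurable (cos_poly N a).
Proof. by apply: bm_sum => i; apply: bm_scale; exact: bm_cosn. Qed.

Lemma cos_polyN N a x : cos_poly N a (- x) = cos_poly N a x.
Proof. by apply: eq_bigr => i _; rewrite cosnN. Qed.

Lemma cos_poly_periodic N a x : cos_poly N a (x + 2 * pi) = cos_poly N a x.
Proof. by apply: eq_bigr => i _; rewrite cosn_periodic. Qed.

Lemma normr_cos_poly_le N a x : `|cos_poly N a x| <= \sum_(i < N) `|a i|.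
Proof.
apply: le_trans (ler_norm_sum _ _ _) _; apply: ler_sum => i _.
by rewrite normrM ler_piMr// normr_cosn_le1.
Qed.

Lemma torus_int_mul_cos_poly (h : R -> R) N a : bounded_measurable h ->
  torus_int (fun x => h x * cos_poly N a x) =
  \sum_(i < N) a i * torus_int (fun x => h x * cosn i x).
Proof.
move=> bh; under eq_torus_int do rewrite mulr_sumr.
have b i : bounded_measurable (fun x => h x * cosn i x).
  by apply: bm_mul => //; exact: bm_cosn.
under eq_torus_int do under eq_bigr do rewrite mulrCA.
rewrite (@torus_int_sum _ _ _ (fun (i : 'I_N) x => a i * (h x * cosn i x))).
  by apply: eq_bigr => i _; rewrite torus_int_scale.
by move=> i; apply: bm_scale.
Qed.

Lemma torus_int_cos_poly_cosn N a i : torus_int (fun x => cos_poly N a x * cosn i x) =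
  if (i < N)%N then cosn_mass i * a i else 0.
Proof.
under eq_torus_int do rewrite mulrC.
rewrite torus_int_mul_cos_poly; last exact: bm_cosn.
under eq_bigr do rewrite cosn_orthogonal.
case: ifPn => [iN|]; last first.
  rewrite -leqNgt => Ni; apply: big1 => j _; rewrite gtn_eqF ?mulr0//.
  exact: leq_trans Ni.
rewrite (bigD1 (Ordinal iN))//= eqxx big1 ?addr0 1?mulrC// => j ji.
by rewrite ifN ?mulr0//; apply: contra ji => /eqP ij; apply/eqP/val_inj.
Qed.

Lemma torus_int_cos_poly_sin N a m :
  torus_int (fun x => cos_poly N a x * sin (m%:R * x)) = 0.
Proof.
under eq_torus_int do rewrite mulrC.
rewrite torus_int_mul_cos_poly; last exact: bm_sin_scaled.
rewrite big1// => i _; under eq_torus_int do rewrite mulrC.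
by rewrite cosn_sin_orthogonal mulr0.
Qed.

Lemma torus_int_cos_poly_sqr N a :
  torus_int (fun x => cos_poly N a x ^+ 2) = \sum_(i < N) cosn_mass i * a i ^+ 2.
Proof.
under eq_torus_int do rewrite expr2.
rewrite torus_int_mul_cos_poly; last exact: bm_cos_poly.
by apply: eq_bigr => i _; rewrite torus_int_cos_poly_cosn ltn_ord; ring.
Qed.

(** Completing the square in each cosine mode.  Both Bessel's inequality and the
    optimality of the Fourier partial sums among cosine polynomials can be read
    off from this identity. *)
Lemma cos_poly_sqr_distance (h : R -> R) N b c : bounded_measurable h ->
  (forall i, torus_int (fun x => h x * cosn i x) = cosn_mass i * b i) ->
  torus_int (fun x => (h x - cos_poly N c x) ^+ 2) =
  torus_int (fun x => h x ^+ 2) - \sum_(i < N) cosn_mass i * b i ^+ 2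
  + \sum_(i < N) cosn_mass i * (b i - c i) ^+ 2.
Proof.
move=> bh hb; have bc := bm_cos_poly N c.
have E x : (h x - cos_poly N c x) ^+ 2 =
  h x * h x - 2 * (h x * cos_poly N c x) + cos_poly N c x * cos_poly N c x by ring.
under eq_torus_int do rewrite E.
have bhc : bounded_measurable (fun x => h x * cos_poly N c x) by exact: bm_mul.
have bhh : bounded_measurable (fun x => h x * h x) by exact: bm_mul.
rewrite torus_int_add; last exact: bm_mul; last by apply: bm_sub => //; exact: bm_scale.
rewrite torus_int_sub//; last exact: bm_scale.
rewrite torus_int_scale// torus_int_mul_cos_poly//.
under eq_bigr do rewrite hb.
under [X in _ + X = _]eq_torus_int do rewrite -expr2.
rewrite torus_int_cos_poly_sqr.
under [X in _ = X - _ + _]eq_torus_int do rewrite expr2.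
rewrite mulr_sumr -!addrA; congr (_ + _).
rewrite -!sumrN -!big_split /=; apply: eq_bigr => i _; ring.
Qed.

Lemma bessel (h : R -> R) N b : bounded_measurable h ->
  (forall i, torus_int (fun x => h x * cosn i x) = cosn_mass i * b i) ->
  \sum_(i < N) cosn_mass i * b i ^+ 2 <= torus_int (fun x => h x ^+ 2).
Proof.
move=> bh hb; rewrite -subr_ge0.
have := cos_poly_sqr_distance N b bh hb.
rewrite [X in _ = _ + X -> _]big1 => [|i _]; last by rewrite subrr expr0n mulr0.
by rewrite addr0 => <-; apply: torus_int_ge0 => x; exact: sqr_ge0.
Qed.

End CosinePolynomials.

(** * A mountain pass theorem in finite dimension *)

Section MountainPass.
Context {R : realType} {n : nat}.
Notation V := 'rV[R]_n.+1.
Implicit Types (x y h : V).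

Definition dotv x y : R := \sum_i x 0 i * y 0 i.

Lemma dotv_ge0 x : 0 <= dotv x x.
Proof. by apply: sumr_ge0 => i _; rewrite -expr2 sqr_ge0. Qed.

Lemma dotv_eq0 x : dotv x x = 0 -> x = 0.
Proof.
move=> /eqP; rewrite psumr_eq0 => [/allP xx|i _]; last by rewrite -expr2 sqr_ge0.
apply/rowP => i; rewrite mxE; apply/eqP; rewrite -[_ == _]orbb -mulf_eq0.
by apply: (xx i); rewrite mem_index_enum.
Qed.

Lemma coord_continuous_rV (i : 'I_n.+1) : continuous (fun x => x 0 i).
Proof. exact: coord_continuous. Qed.

Lemma continuous_sum (T : topologicalType) (I : Type) (s : seq I) (F : I -> T -> R) :
  (forall i, continuous (F i)) -> continuous (fun t => \sum_(i <- s) F i t).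
Proof.
move=> cF t; apply: cvg_big => [|i _]; last exact: cF.
exact: add_continuous.
Qed.

Lemma dotv_continuous (D : V -> V) : continuous D -> continuous (fun x => dotv (D x) (D x)).
Proof.
move=> cD; apply: continuous_sum => i x.
have c : {for x, continuous (fun x => D x 0 i)}.
  by apply: (@continuous_comp _ _ _ D (fun y => y 0 i)); [exact: cD | exact: coord_continuous_rV].
exact: continuousM.
Qed.

Lemma connected_crosses_sphere (C : set V) x e (r : R) : connected C ->
  C x -> C e -> 0 <= r -> r <= `|e - x| -> exists2 y, C y & `|y - x| = r.
Proof.
move=> cC Cx Ce r0 re.
have : connected ((fun y => `|y - x|) @` C).
  apply: connected_continuous_connected => //; apply: continuous_subspaceT => y.
  apply: (@continuous_comp _ _ _ (fun y => y - x) (fun y => `|y|)); last exact: norm_continuous.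
  by apply: continuousB; [exact: cvg_id | exact: cst_continuous].
move/connected_intervalP => /(_ 0 `|e - x|) itv.
have [|||y Cy yr] := itv _ _ r.
- by exists x; rewrite // subrr normr0.
- by exists e.
- by rewrite r0.
- by exists y.
Qed.

(** One explicit gradient step of length [1 / L] takes the place of the gradient
    flow of the classical deformation lemma: it is continuous, fixes critical
    points and never increases [E], and wherever the gradient is bounded away
    from zero it decreases [E] by a definite amount.  Without a critical value
    in the relevant range, finitely many steps would push [C] below the barrier
    around [x0], although its image stays connected and keeps both ends. *)
Theorem mountain_pass (E : V -> R) (D : V -> V) (L : R) x0 e (C : set V)
    (r delta level gamma : R) :
  0 < L ->
  (forall x h, E (x + h) <= E x + dotv (D x) h + L / 2 * dotv h h) ->
  continuous E -> continuous D ->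
  0 < gamma -> bounded_set [set x | dotv (D x) (D x) <= gamma] ->
  D x0 = 0 -> 0 < r -> 0 < delta ->
  (forall x, `|x - x0| <= r -> E x0 <= E x) ->
  (forall x, `|x - x0| = r -> E x0 + delta <= E x) ->
  connected C -> C x0 -> C e -> E e < E x0 -> (forall x, C x -> E x <= level) ->
  exists x, [/\ D x = 0, E x0 < E x & E x <= level].
Proof.
move=> L0 descent cE cD g0 bD Dx0 r0 d0 inside barrier cC Cx0 Ce Ee Clevel.
apply: contrapT => nocrit.
pose d2 := delta / 2.
pose band : set V := [set x | E x0 + d2 <= E x] `&` [set x | E x <= level].
have d20 : 0 < d2 by rewrite /d2; lra.
(* [gamma] confines small gradients to a compact set, where the absence of
   critical points bounds the gradient from below. *)
have [k k0 kband] : exists2 k : R, 0 < k & forall x, band x -> k <= dotv (D x) (D x).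
  pose K := band `&` [set x | dotv (D x) (D x) <= gamma].
  have [[x1 Kx1]|K0] := pselect (K !=set0); last first.
    exists gamma => // x bx; rewrite leNgt; apply/negP => xg.
    by apply: K0; exists x; split => //=; exact: ltW.
  have clK : closed K.
    apply: closedI; first apply: closedI.
    - by apply: (@preimage_closed _ _ E [set y | E x0 + d2 <= y]) => [x _|]; [exact: cE | exact: closed_ge].
    - by apply: (@preimage_closed _ _ E [set y | y <= level]) => [x _|]; [exact: cE | exact: closed_le].
    - apply: (@preimage_closed _ _ (fun x => dotv (D x) (D x)) [set y | y <= gamma]) => [x _|].
        exact: dotv_continuous.
      exact: closed_le.
  have cK : compact K.
    apply: bounded_closed_compact => //.
    by case: bD => M [Mr bM]; exists M; split => // t Mt x [_ xg]; exact: bM.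
  have [||x2 Kx2 minx2] := @EVT_min_rV R _ (fun x => dotv (D x) (D x)) K _ cK.
  - by exists x1.
  - exact/continuous_subspaceT/dotv_continuous.
  move: Kx2; rewrite inE => -[[/= x2l x2u] x2g].
  have D2 : 0 < dotv (D x2) (D x2).
    rewrite lt_neqAle dotv_ge0 andbT eq_sym; apply/negP => /eqP/dotv_eq0 Dx2.
    apply: nocrit; exists x2; split => //; apply: lt_le_trans x2l; lra.
  exists (Num.min gamma (dotv (D x2) (D x2))); first by rewrite lt_min g0.
  move=> x bx; rewrite ge_min.
  have [xg|/ltW ->//] := leP (dotv (D x) (D x)) gamma.
  by rewrite minx2 ?orbT// inE.
pose T x : V := x - L^-1 *: D x.
have cT : continuous T.
  move=> x; apply: (@continuousB _ _ _ (fun y : V => y) (fun y => L^-1 *: D y)).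
    exact: cvg_id.
  by apply: (@continuousZ _ _ _ (fun=> L^-1) D); [exact: cst_continuous | exact: cD].
have ET x : E (T x) <= E x - dotv (D x) (D x) / (2 * L).
  apply: le_trans (descent _ _) _.
  have -> : dotv (D x) (- (L^-1 *: D x)) = - (L^-1 * dotv (D x) (D x)).
    by rewrite /dotv mulr_sumr -sumrN; apply: eq_bigr => i _; rewrite !mxE; ring.
  have -> : dotv (- (L^-1 *: D x)) (- (L^-1 *: D x)) = L^-1 ^+ 2 * dotv (D x) (D x).
    by rewrite /dotv mulr_sumr; apply: eq_bigr => i _; rewrite !mxE; ring.
  rewrite le_eqVlt; apply/orP; left; apply/eqP; field.
  by rewrite gt_eqF.
have Tx0 : T x0 = x0 by rewrite /T Dx0 scaler0 subr0.
have ETle x : E (T x) <= E x.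
  apply: le_trans (ET x) _; rewrite gerBl divr_ge0 ?dotv_ge0//; lra.
(* The invariant of the iteration: each step lowers the maximum of [E] by
   [k / (2 * L)] until it reaches [E x0 + d2]. *)
have step j : exists C' e', [/\ connected C', C' x0, C' e', E e' < E x0 &
    forall x, C' x -> E x <= level /\
      E x <= Num.max (level - j%:R * (k / (2 * L))) (E x0 + d2)].
  elim: j => [|j [C' [e' [cC' C'x0 C'e' Ee' C'lev]]]].
    exists C, e; split => // x Cx; split; first exact: Clevel.
    by rewrite mul0r subr0 le_max Clevel.
  exists (T @` C'), (T e'); split.
  - by apply: connected_continuous_connected => //; exact: continuous_subspaceT.
  - by exists x0.
  - by exists e'.
  - exact: le_lt_trans Ee'.
  move=> _ [x C'x <-]; have [xl xm] := C'lev x C'x; split; first exact: le_trans (ETle x) xl.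
  have [low|high] := leP (E x) (E x0 + d2).
    by rewrite le_max (le_trans (ETle x) low) orbT.
  move: xm; rewrite !le_max => /orP[xm|]; last by rewrite leNgt high.
  apply/orP; left; apply: le_trans (ET x) _.
  have kx : k / (2 * L) <= dotv (D x) (D x) / (2 * L).
    apply: ler_pM => //; [exact: ltW | by rewrite invr_ge0; lra |].
    by apply: kband; split => //=; exact: ltW.
  have -> : j.+1%:R * (k / (2 * L)) = j%:R * (k / (2 * L)) + k / (2 * L).
    by rewrite -[j.+1%:R]natr1 [LHS]mulrDl mul1r.
  by rewrite opprD addrA lerB.
pose j := (Num.truncn ((level - E x0) / (k / (2 * L)))).+1.
have k2L : 0 < k / (2 * L) by rewrite divr_gt0//; lra.
have jbig : level - j%:R * (k / (2 * L)) <= E x0 + d2.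
  have : (level - E x0) / (k / (2 * L)) < j%:R by exact: Num.Theory.truncnS_gt.
  by rewrite ltr_pdivrMr// => lt_j; rewrite lerBlDr -lerBlDl; apply: ltW; apply: le_lt_trans lt_j; lra.
have [C' [e' [cC' C'x0 C'e' Ee' C'lev]]] := step j.
have far : r < `|e' - x0|.
  by rewrite ltNge; apply/negP => /inside; rewrite leNgt Ee'.
have [y C'y yr] := connected_crosses_sphere cC' C'x0 C'e' (ltW r0) (ltW far).
have [_] := C'lev y C'y; rewrite max_r// => Ey.
by have := barrier y yr; rewrite /d2 in Ey; lra.
Qed.

End MountainPass.

(** * Antiderivatives *)

Section Calculus.
Context {R : realType}.
Implicit Types (f F : R -> R) (x y s t h K : R).

Lemma continuous_integrable_itv f (a b : R) : continuous f ->
  lebesgue_measure.-integrable `[a, b] (EFin \o f).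
Proof.
move=> cf; apply: continuous_compact_integrable; first exact: segment_compact.
exact: continuous_subspaceT.
Qed.

(** Near each point the signed integral from [0] differs by a constant from an
    integral based far enough to the left, to which the one-sided fundamental
    theorem of calculus applies. *)
Lemma continuous_antiderivative f : continuous f ->
  exists F, F 0 = 0 /\ forall x : R, is_derive x (1 : R) F (f x).
Proof.
move=> cf.
pose J (i : interval R) := Rintegral lebesgue_measure [set` i] f.
pose F x := J `]0, x] - J `]x, 0].
have F0 : F 0 = 0 by rewrite /F subrr.
have FE (a x : R) : a < x -> a < 0 -> F x = J `[a, x] - J `[a, 0].
  move=> ax a0; rewrite /F.
  have [x0|x0] := leP 0 x.
    rewrite [X in _ - X](_ : _ = 0) ?subr0; last first.
      by rewrite /J set_itv_ge ?Rintegral_set0// bnd_simp -leNgt.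
    rewrite /J (@Rintegral_itvB _ f (BLeft a) (BRight x) 0)//.
    - exact: continuous_integrable_itv.
    - by rewrite bnd_simp ltW.
  rewrite [X in X - _](_ : _ = 0) ?sub0r; last first.
    by rewrite /J set_itv_ge ?Rintegral_set0// bnd_simp -leNgt ltW.
  rewrite -opprB; congr (- _).
  rewrite /J (@Rintegral_itvB _ f (BLeft a) (BRight 0) x)//.
  - exact: continuous_integrable_itv.
  - by rewrite bnd_simp ltW.
  - by rewrite bnd_simp ltW.
exists F; split=> // x.
pose a : R := - (`|x| + 1).
have ax : a < x by rewrite /a; have := ler_norm (- x); rewrite normrN; lra.
have a0 : a < 0 by rewrite /a; have := normr_ge0 x; lra.
have xx1 : x < x + 1 by lra.
have [dJ Jf] : derivable (fun y => J `[a, y]%R) x 1 /\ (fun y => J `[a, y]%R)^`()%classic x = f x.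
  by apply: (@continuous_FTC1_closed _ f a x (x + 1)) => //;
    [exact: continuous_integrable_itv | exact: cf].
apply: (@near_eq_is_derive _ _ _ (fun y => J `[a, y]%R - J `[a, 0]%R)).
  near=> y; rewrite (FE a)//; near: y; exact: lt_nbhsr.
have dJ' : is_derive x (1 : R) (fun y => J `[a, y]%R) (f x).
  by apply: DeriveDef => //; rewrite -derive1E.
by apply: is_derive_eq; rewrite subr0.
Unshelve. all: by end_near. Qed.

Lemma max_of_derive_sign (psi dpsi : R -> R) s t :
  (forall x : R, is_derive x (1 : R) psi (dpsi x)) ->
  (forall y, Num.min s t <= y <= Num.max s t -> (y - t) * dpsi y <= 0) ->
  psi s <= psi t.
Proof.
move=> dp sgn.
have cpsi : continuous psi.
  by move=> x; apply/differentiable_continuous/derivable1_diffP; have [] := dp x.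
have [st|ts|->//] := ltgtP s t.
- have [y yst E] := @MVT _ psi dpsi _ _ st (fun x _ => dp x) (continuous_subspaceT cpsi).
  move: yst; rewrite in_itv /= => /andP[sy yt].
  have := sgn y; rewrite min_l ?max_r ?(ltW st)// (ltW sy) (ltW yt) => /(_ isT) H.
  have d0 : 0 <= dpsi y by rewrite -(@nmulr_rle0 _ (y - t))// subr_lt0.
  by rewrite -subr_ge0 E mulr_ge0// subr_ge0 ltW.
- have [y yst E] := @MVT _ psi dpsi _ _ ts (fun x _ => dp x) (continuous_subspaceT cpsi).
  move: yst; rewrite in_itv /= => /andP[sy yt].
  have := sgn y; rewrite min_r ?max_l ?(ltW ts)// (ltW sy) (ltW yt) => /(_ isT) H.
  have d0 : dpsi y <= 0 by rewrite -(@pmulr_rle0 _ (y - t))// subr_gt0.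
  by rewrite -subr_le0 E mulr_le0_ge0// subr_ge0 ltW.
Qed.

Lemma lipschitz_continuous f K : (forall x y, `|f x - f y| <= K * `|x - y|) -> continuous f.
Proof.
move=> lf x; apply/cvgrPdist_le => e e0.
have K1 : 0 < `|K| + 1 by have := normr_ge0 K; lra.
near=> y; apply: le_trans (lf x y) _.
have : `|x - y| <= e / (`|K| + 1).
  by near: y; apply: cvgr_dist_le; [exact: cvg_id | rewrite divr_gt0].
rewrite ler_pdivlMr// => H; apply: le_trans H.
by rewrite mulrC ler_wpM2l//; have := ler_norm K; lra.
Unshelve. all: by end_near. Qed.

(** With the sign [e], the error term minus [K / 2 * (s - t) ^+ 2] has a derivative
    pointing towards [t], hence is at most its value [0] at [t]. *)
Lemma first_order_expansion f F K :
  (forall x : R, is_derive x (1 : R) F (f x)) ->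
  (forall x y, `|f x - f y| <= K * `|x - y|) ->
  forall t h, `|F (t + h) - F t - f t * h| <= K / 2 * h ^+ 2.
Proof.
move=> dF lf t h.
have sgn (e : R) : e ^+ 2 = 1 -> e * (F (t + h) - F t - f t * h) <= K / 2 * h ^+ 2.
  move=> e1.
  pose psi s := e * F s - e * f t * (s - t) - K / 2 * (s - t) ^+ 2.
  pose dpsi s := e * (f s - f t) - K * (s - t).
  have dp (x : R) : is_derive x (1 : R) psi (dpsi x).
    have dFx := dF x.
    by apply: is_derive_eq; rewrite /GRing.scale /= /dpsi; field.
  have : psi (t + h) <= psi t.
    apply: (max_of_derive_sign dp) => y _; rewrite /dpsi mulrBr subr_le0.
    have en : `|e| = 1 by move/eqP: e1; rewrite sqrf_eq1 => /orP[]/eqP ->; rewrite ?normrN normr1.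
    apply: le_trans (ler_norm _) _.
    rewrite !normrM en mul1r; apply: le_trans (ler_wpM2l (normr_ge0 _) (lf y t)) _.
    rewrite le_eqVlt; apply/orP; left; apply/eqP.
    by rewrite mulrCA -expr2 real_normK ?num_real//; ring.
  rewrite /psi subrr (addrC t h) addrK; lra.
have up := sgn 1 (expr1n _ _).
have lo : -1 * (F (t + h) - F t - f t * h) <= K / 2 * h ^+ 2.
  by apply: sgn; rewrite sqrrN expr1n.
rewrite mul1r in up; rewrite mulN1r in lo.
by rewrite ler_norml up andbT lerNl.
Qed.

End Calculus.

(** * Truncation of the power nonlinearity *)

Section Truncation.
Context {R : realType}.
Context (q M : R) (q1 : 1 <= q) (M0 : 0 < M).
Implicit Types (r s t x y c : R).

(** The power [`|t| `^ (q + 1)], with linear growth beyond [M]: it is globally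
    Lipschitz, so that one step length serves for all gradient steps, and the a
    priori bounds do not depend on [M]. *)
Definition trunc_power t : R := Num.min `|t| M `^ q * `|t|.

Let q0 : 0 <= q. Proof. exact: le_trans ler01 q1. Qed.

Lemma le_powR_base x y : 0 <= x -> x <= y -> x `^ q <= y `^ q.
Proof. by move=> x0 xy; apply: ge0_ler_powR; rewrite ?nnegrE// (le_trans x0). Qed.

(** From [exp z >= 1 + z] and [ln z >= 1 - 1 / z] with [z = x / y]; the factor [x]
    compensates the singularity of the second bound at [x = 0]. *)
Lemma powR_tangent_le x y : 0 <= x -> x <= y ->
  x * (y `^ q - x `^ q) <= q * y `^ q * (y - x).
Proof.
move=> x0 xy; have [->|xn0] := eqVneq x 0.
  by rewrite mul0r subr0 !mulr_ge0// ?powR_ge0// (le_trans x0).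
have xp : 0 < x by rewrite lt_neqAle eq_sym xn0.
have yp : 0 < y by apply: lt_le_trans xy.
have E : x `^ q = y `^ q * expR (q * ln (x / y)).
  rewrite -[X in X `^ q](@mulfVK _ y) ?gt_eqF// mulrC powRM ?divr_ge0 ?ltW//.
  by congr (_ * _); rewrite /powR gt_eqF// divr_gt0.
have L : 1 - y / x <= ln (x / y).
  have -> : ln (x / y) = - ln (y / x) by rewrite -invf_div lnV ?opprK// posrE divr_gt0.
  have := @le_ln1Dx R (y / x - 1); rewrite (addrC 1) subrK => H.
  by rewrite lerNr opprB; apply: H; have := divr_gt0 yp xp; lra.
have X : 1 + q * (1 - y / x) <= expR (q * ln (x / y)).
  by apply: le_trans (expR_ge1Dx _); rewrite lerD2l ler_wpM2l.
have -> : q * y `^ q * (y - x) = x * (y `^ q * (1 - (1 + q * (1 - y / x)))).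
  by field.
rewrite E -[X in x * (X - _)]mulr1 -mulrBr ler_wpM2l// ler_wpM2l ?powR_ge0//; lra.
Qed.

Lemma trunc_power_ge0 t : 0 <= trunc_power t.
Proof. by rewrite mulr_ge0 ?powR_ge0. Qed.

Lemma trunc_power_eq t : `|t| <= M -> trunc_power t = `|t| `^ (q + 1).
Proof.
move=> tM; rewrite /trunc_power min_l// powRD ?powRr1//.
by rewrite [_ + 1 == 0]gt_eqF//; have := q1; lra.
Qed.

Lemma trunc_power_le t : trunc_power t <= `|t| `^ (q + 1).
Proof.
have qn : q + 1 != 0 by rewrite gt_eqF//; have := q1; lra.
rewrite powRD ?(negbTE qn)// powRr1//; apply: ler_wpM2r => //.
by apply: le_powR_base; [rewrite le_min normr_ge0 ltW | rewrite ge_min lexx].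
Qed.

Lemma trunc_power_small r t : `|t| <= r -> trunc_power t <= r `^ q * `|t|.
Proof.
move=> tr; apply: ler_wpM2r => //.
by apply: le_powR_base; [rewrite le_min normr_ge0 ltW | rewrite ge_min tr].
Qed.

Lemma trunc_power_superlinear m t : 0 <= m -> m <= M ->
  m `^ q * `|t| <= trunc_power t + m `^ q * m.
Proof.
move=> m0 mM; have mq := powR_ge0 m q.
have [tm|mt] := leP `|t| m.
  by rewrite -[leLHS]add0r lerD ?trunc_power_ge0// ler_wpM2l.
rewrite -[leLHS]addr0 lerD ?mulr_ge0// ler_wpM2r// le_powR_base//.
by rewrite le_min (ltW mt).
Qed.

Lemma trunc_power_lipschitz x y :
  `|trunc_power x - trunc_power y| <= (1 + q) * M `^ q * `|x - y|.
Proof.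
apply: le_trans (_ : (1 + q) * M `^ q * `| `|x| - `|y| | <= _); last first.
  by rewrite ler_wpM2l ?ler_dist_dist// mulr_ge0 ?powR_ge0//; have := q1; lra.
rewrite /trunc_power; move: (normr_ge0 x) (normr_ge0 y).
move: `|x| `|y| => {}x {}y; wlog xy : x y / x <= y.
  move=> H x0 y0; have /orP[xy|yx] := le_total x y; first exact: H.
  by rewrite distrC [X in _ <= _ * X]distrC; exact: H.
move=> x0 y0; rewrite distrC [X in _ <= _ * X]distrC.
(* Product rule: the second difference vanishes when [x] is beyond [M]. *)
have -> : Num.min y M `^ q * y - Num.min x M `^ q * x =
  Num.min y M `^ q * (y - x) + x * (Num.min y M `^ q - Num.min x M `^ q) by ring.
have miny : 0 <= Num.min y M by rewrite le_min y0 ltW.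
have minx : 0 <= Num.min x M by rewrite le_min x0 ltW.
have minxy : Num.min x M <= Num.min y M.
  by rewrite le_min !ge_min xy lexx orbT.
have pM : Num.min y M `^ q <= M `^ q by rewrite le_powR_base// ge_min lexx orbT.
have yx : 0 <= y - x by rewrite subr_ge0.
have d0 : 0 <= x * (Num.min y M `^ q - Num.min x M `^ q).
  by rewrite mulr_ge0// subr_ge0 le_powR_base.
rewrite !ger0_norm//; last by rewrite addr_ge0// mulr_ge0 ?powR_ge0.
rewrite mulrDl mulrDl mul1r lerD//; first by rewrite ler_wpM2r.
have [Mx|xM] := leP M x.
  by rewrite !min_r ?(le_trans Mx)// subrr mulr0 !mulr_ge0// powR_ge0.
have := powR_tangent_le x0 (_ : x <= Num.min y M).
rewrite le_min xy ltW// => /(_ isT)/le_trans; apply.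
apply: ler_pM.
- by rewrite mulr_ge0 ?powR_ge0.
- by rewrite subr_ge0 le_min xy ltW.
- by rewrite ler_wpM2l.
- by rewrite lerD2r ge_min lexx.
Qed.

Section NegativeZero.
Context (lam c : R) (c0 : 0 < c) (cM : 2 * c <= M) (lamE : lam = c `^ q).

Let lam0 : 0 < lam. Proof. by rewrite lamE powR_gt0. Qed.

Lemma reaction_le0 t : - c <= t -> t <= 0 -> lam * t + trunc_power t <= 0.
Proof.
move=> ct t0; rewrite /trunc_power ler0_norm//.
have tc : - t <= c by rewrite lerNl.
have : Num.min (- t) M `^ q <= lam.
  rewrite lamE le_powR_base ?ge_min ?tc// le_min oppr_ge0 t0 ltW//.
by move=> /(ler_wpM2r (_ : 0 <= - t)); rewrite oppr_ge0 => /(_ t0); lra.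
Qed.

(** Near its zero [- c] the reaction term [lam * t + trunc_power t] is strictly
    decreasing, with slope at most [- lam / 2] on secants through that zero. *)
Lemma reaction_sign t : t <= - (c / 2) ->
  (t + c) * (lam * t + trunc_power t) <= - (lam / 2) * (t + c) ^+ 2.
Proof.
have c_gt0 := c0; have q_ge1 := q1; have lam_gt0 := lam0; have c_le_M := cM.
move=> tc; have t0 : t <= 0 by lra.
rewrite /trunc_power ler0_norm//; set x := - t.
have -> : t = - x by rewrite opprK.
have xc : c / 2 <= x by rewrite /x; lra.
have x0 : 0 < x by lra.
have q10 : 0 <= q - 1 by lra.
have split z : 0 < z -> z `^ q = z `^ (q - 1) * z.
  move=> z0; have := @powRD R z (q - 1) 1.
    by rewrite subrK powRr1 ?ltW// (gt_eqF z0) implybT => ->.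
have le1 z w : 0 <= z -> z <= w -> z `^ (q - 1) <= w `^ (q - 1).
  by move=> z0 zw; apply: ge0_ler_powR; rewrite ?nnegrE// (le_trans z0).
have lamc : lam = c `^ (q - 1) * c by rewrite lamE split.
have b0 := powR_ge0 c (q - 1).
have [xM|Mx] := leP x M; last first.
  have Mq : 2 * lam <= M `^ q.
    rewrite split// lamc mulrCA; apply: ler_pM => //; [lra | apply: le1; lra].
  have : 0 <= (x - c) * (x * (M `^ q - 2 * lam)).
    by rewrite !mulr_ge0//; lra.
  have : 0 <= (x - c) * (lam * (x - (x - c) / 2)) by rewrite !mulr_ge0//; lra.
  lra.
have [cx|xlc] := leP c x.
  have xq : 0 <= x `^ q - c `^ (q - 1) * x.
    by rewrite subr_ge0 [leRHS]split// ler_wpM2r ?le1//; lra.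
  have : 0 <= (x - c) * (x * (x `^ q - c `^ (q - 1) * x)) by rewrite !mulr_ge0//; lra.
  have : 0 <= (x - c) * ((x - c) * (c `^ (q - 1) * (x - c / 2))).
    by rewrite !mulr_ge0//; lra.
  rewrite lamc; lra.
have xq : 0 <= c `^ (q - 1) * x - x `^ q.
  by rewrite subr_ge0 [leLHS]split// ler_wpM2r ?le1//; lra.
have : 0 <= (c - x) * (x * (c `^ (q - 1) * x - x `^ q)) by rewrite !mulr_ge0//; lra.
have : 0 <= (c - x) * ((c - x) * (c `^ (q - 1) * (x - c / 2))).
  by rewrite !mulr_ge0//; lra.
rewrite lamc; lra.
Qed.

End NegativeZero.

End Truncation.

(** * Galerkin solutions of mountain pass type *)

Lemma continuous_locally_lipschitz {R : realType} (V W : normedModType R) (E : V -> W) (x : V) (C : R) :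
  (forall h, `|h| <= 1 -> `|E (x + h) - E x| <= C * `|h|) -> {for x, continuous E}.
Proof.
move=> lE; apply/cvgrPdist_le => e e0.
have C1 : 0 < `|C| + 1 by have := normr_ge0 C; lra.
near=> y.
have -> : y = x + (y - x) by rewrite addrC subrK.
rewrite distrC; apply: le_trans (lE _ _) _.
  by rewrite distrC; near: y; apply: cvgr_dist_le; [exact: cvg_id | exact: ltr01].
have : `|x - y| <= e / (`|C| + 1).
  by near: y; apply: cvgr_dist_le; [exact: cvg_id | rewrite divr_gt0].
rewrite ler_pdivlMr// distrC => H; apply: le_trans H.
by rewrite mulrC ler_wpM2l//; have := ler_norm C; lra.
Unshelve. all: by end_near. Qed.

Section RowVectors.
Context {R : realType} {n : nat}.
Notation V := 'rV[R]_n.+1.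
Implicit Types (x h : V).

Lemma norm_coord_le x i : `|x 0 i| <= `|x|.
Proof. by rewrite {2}/Num.norm /= mx_normrE; apply: (le_bigmax _ (fun k : 'I_1 * 'I_n.+1 => `|x k.1 k.2|) (0, i)). Qed.

Lemma norm_rV_le x (e : R) : 0 <= e -> (forall i, `|x 0 i| <= e) -> `|x| <= e.
Proof.
move=> e0 xe; rewrite /Num.norm /= mx_normrE; apply: bigmax_le => // -[i j] _ /=.
by rewrite ord1.
Qed.

Lemma sqr_norm_le_dotv x : `|x| ^+ 2 <= dotv x x.
Proof.
rewrite -[leRHS]sqr_sqrtr ?dotv_ge0// lerXn2r ?nnegrE ?sqrtr_ge0//.
apply: norm_rV_le => [|i]; first exact: sqrtr_ge0.
rewrite -sqrtr_sqr ler_wsqrtr// /dotv (bigD1 i)//= -expr2 lerDl.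
by apply: sumr_ge0 => j _; rewrite -expr2 sqr_ge0.
Qed.

Lemma dotv_le_sqr_norm x : dotv x x <= n.+1%:R * `|x| ^+ 2.
Proof.
apply: le_trans (_ : \sum_(i < n.+1) `|x| ^+ 2 <= _).
  apply: ler_sum => i _; rewrite -expr2 -real_normK ?num_real//.
  by rewrite lerXn2r ?nnegrE// norm_coord_le.
by rewrite sumr_const card_ord mulr_natl.
Qed.

End RowVectors.

Section Galerkin.
Context {R : realType} (w : nat -> R) (f F : R -> R) (lam c r K C0 : R).
Context (w0 : w 0%N = 0) (w1 : w 1%N = 1) (w_ge0 : forall i, 0 <= w i)
  (lam1 : 1 < lam) (c0 : 0 < c) (r0 : 0 < r) (rc : r <= c)
  (f_ge0 : forall t, 0 <= f t)
  (f_lip : forall x y, `|f x - f y| <= K * `|x - y|)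
  (F0 : F 0 = 0) (dF : forall x : R, is_derive x (1 : R) F (f x))
  (f_small : forall t, `|t| <= r -> f t <= (lam - 1) / 2 * `|t|)
  (f_superlinear : forall t, 2 * lam * `|t| <= f t + C0)
  (f_c : f (- c) = lam * c)
  (react_le0 : forall t, - c <= t -> t <= 0 -> lam * t + f t <= 0)
  (react_sign : forall t, t <= - (c / 2) ->
    (t + c) * (lam * t + f t) <= - (lam / 2) * (t + c) ^+ 2).
Implicit Types (t s : R).

Definition react t : R := lam * t + f t.
Definition react_pot t : R := lam / 2 * t ^+ 2 + F t.

Let cf : continuous f. Proof. exact: lipschitz_continuous f_lip. Qed.

Lemma react_pot_derive (x : R) : is_derive x (1 : R) react_pot (react x).
Proof.
have dFx := dF x; apply: is_derive_eq.
by rewrite /react /GRing.scale /=; field.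
Qed.

Lemma react_lip s t : `|react s - react t| <= (lam + K) * `|s - t|.
Proof.
have l0 : 0 <= lam by have := lam1; lra.
have -> : react s - react t = lam * (s - t) + (f s - f t) by rewrite /react; ring.
by rewrite (le_trans (ler_normD _ _))// normrM (ger0_norm l0) mulrDl lerD2l f_lip.
Qed.

Lemma react_continuous : continuous react.
Proof. exact: lipschitz_continuous react_lip. Qed.

Lemma react_pot_continuous : continuous react_pot.
Proof.
by move=> x; apply/differentiable_continuous/derivable1_diffP; have [] := react_pot_derive x.
Qed.

Lemma F_continuous : continuous F.
Proof.
by move=> x; apply/differentiable_continuous/derivable1_diffP; have [] := dF x.
Qed.

(** [- c] is a strict maximum of the potential on a half-line, because the
    reaction term points towards it at a definite rate. *)
Lemma react_pot_le_max t : t <= - (c / 2) ->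
  react_pot t + lam / 4 * (t + c) ^+ 2 <= react_pot (- c).
Proof.
move=> tc; pose psi s := react_pot s + lam / 4 * (s + c) ^+ 2.
have dpsi (x : R) : is_derive x (1 : R) psi (react x + lam / 2 * (x + c)).
  have dG := react_pot_derive x; apply: is_derive_eq.
  by rewrite /GRing.scale /=; field.
have := max_of_derive_sign (s := t) (t := - c) dpsi.
rewrite /psi addNr expr0n mulr0 addr0; apply => y /andP[_ yle].
have yc : y <= - (c / 2).
  by apply: le_trans yle _; rewrite ge_max tc; have := c0; lra.
by have := react_sign yc; rewrite opprK /react; lra.
Qed.

Lemma F_small t : `|t| <= r -> `|F t| <= (lam - 1) / 4 * t ^+ 2.
Proof.
move=> tr; have sgn (e : R) : `|e| = 1 -> e * F t <= (lam - 1) / 4 * t ^+ 2.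
  move=> e1; pose psi s := e * F s - (lam - 1) / 4 * s ^+ 2.
  have dpsi (x : R) : is_derive x (1 : R) psi (e * f x - (lam - 1) / 2 * x).
    have dFx := dF x; apply: is_derive_eq.
    by rewrite /GRing.scale /=; field.
  have := max_of_derive_sign (s := t) (t := 0) dpsi.
  rewrite /psi F0 expr0n !mulr0 subrr subr_le0; apply => y yt.
  have yr : `|y| <= r.
    move: tr yt; rewrite ler_norml [in X in _ -> _ -> X]ler_norml => /andP[t1 t2].
    by rewrite ge_min le_max => /andP[/orP[] y1 /orP[] y2]; have := r0; lra.
  rewrite subr0 mulrBr subr_le0; apply: le_trans (ler_norm _) _.
  rewrite !normrM e1 mul1r (ger0_norm (f_ge0 y)).
  have := ler_wpM2l (normr_ge0 y) (f_small yr).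
  by rewrite mulrCA -expr2 real_normK ?num_real// expr2 mulrCA.
rewrite ler_norml; have := sgn 1 (normr1 _); rewrite mul1r => ->.
by have := sgn (-1); rewrite normrN1 mulN1r lerNl => ->.
Qed.

Lemma react_pot_small t : `|t| <= r -> (lam + 1) / 4 * t ^+ 2 <= react_pot t.
Proof. by move=> /F_small; rewrite ler_norml /react_pot => /andP[+ _]; lra. Qed.

(** Monotonicity of the potential on both sides of [0] propagates the quadratic
    lower bound from [`|t| = r]. *)
Lemma react_pot_far t : - c <= t -> r <= `|t| -> (lam + 1) / 4 * r ^+ 2 <= react_pot t.
Proof.
have r_gt0 := r0; have lam_gt1 := lam1; have r_le_c := rc.
have dN (x : R) : is_derive x (1 : R) (fun s => - react_pot s) (- react x).
  exact: is_deriveN (react_pot_derive x).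
move=> ct rt; case: (lerP 0 t) => t0.
  rewrite ger0_norm// in rt.
  have rr : `|r| <= r by rewrite gtr0_norm.
  apply: le_trans (react_pot_small rr) _.
  rewrite -lerN2; apply: (max_of_derive_sign dN) => y.
  rewrite min_r ?max_l// => /andP[ry _].
  have := f_ge0 y; have : 0 <= lam * y by rewrite mulr_ge0//; lra.
  by rewrite mulrN oppr_le0 /react => h1 h2; rewrite mulr_ge0//; lra.
rewrite ltr0_norm// in rt.
apply: le_trans (_ : (lam + 1) / 4 * (- r) ^+ 2 <= _); first by rewrite sqrrN.
have rr : `|- r| <= r by rewrite normrN gtr0_norm.
apply: le_trans (react_pot_small rr) _.
rewrite -lerN2; apply: (max_of_derive_sign dN) => y.
rewrite min_l ?max_r; try lra; move=> /andP[ty yr].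
have := react_le0 (t := y); rewrite -/(react y) => /(_ _ _) H.
have {}H : react y <= 0 by apply: H; lra.
by rewrite mulrN -mulNr mulr_ge0_le0//; lra.
Qed.

Lemma react_pot_ge_sqr t : 0 <= t -> lam / 2 * t ^+ 2 <= react_pot t.
Proof.
move=> t0; rewrite lerDl -F0 -lerN2.
have dN (x : R) : is_derive x (1 : R) (fun s => - F s) (- f x).
  exact: is_deriveN (dF x).
apply: (max_of_derive_sign dN) => y; rewrite min_r ?max_l// => /andP[y0 _].
by rewrite mulrN oppr_le0 subr0 mulr_ge0.
Qed.


Section FixedDimension.
Context (n : nat).
Notation V := 'rV[R]_n.+2.
Implicit Types (a h : V).

Definition coefs a : nat -> R := fun i => if (i < n.+2)%N then a 0 (inord i) else 0.

Lemma coefsE a (i : 'I_n.+2) : coefs a i = a 0 i.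
Proof. by rewrite /coefs ltn_ord inord_val. Qed.

Definition wave a : R -> R := cos_poly n.+2 (coefs a).

Lemma waveE a x : wave a x = \sum_i a 0 i * cosn i x.
Proof. by apply: eq_bigr => i _; rewrite coefsE. Qed.

Lemma waveD a h x : wave (a + h) x = wave a x + wave h x.
Proof. by rewrite !waveE -big_split; apply: eq_bigr => i _; rewrite mxE mulrDl. Qed.

Lemma bm_wave a : bounded_measurable (wave a).
Proof. exact: bm_cos_poly. Qed.

Lemma norm_wave_le a x : `|wave a x| <= n.+2%:R * `|a|.
Proof.
apply: le_trans (normr_cos_poly_le _ _ _) _.
apply: le_trans (_ : \sum_(i < n.+2) `|a| <= _).
  by apply: ler_sum => i _; rewrite coefsE norm_coord_le.
by rewrite sumr_const card_ord mulr_natl.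
Qed.

Lemma torus_int_wave_sqr a :
  torus_int (fun x => wave a x ^+ 2) = \sum_(i < n.+2) cosn_mass i * a 0 i ^+ 2.
Proof.
by rewrite torus_int_cos_poly_sqr; apply: eq_bigr => i _; rewrite coefsE.
Qed.

Let bm_react a : bounded_measurable (fun x => react (wave a x)).
Proof. exact: (bm_comp react_continuous (bm_wave a)). Qed.

Let bm_pot a : bounded_measurable (fun x => react_pot (wave a x)).
Proof. exact: (bm_comp react_pot_continuous (bm_wave a)). Qed.

(** The gradient is taken in the coordinates of [a], so that critical points solve
    the equation tested with each of the first [n.+2] modes. *)
Definition energy a : R :=
  2^-1 * \sum_(i < n.+2) w i * cosn_mass i * a 0 i ^+ 2
  - torus_int (fun x => react_pot (wave a x)).

Definition energy_gradient a : V :=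
  \row_i (w i * cosn_mass i * a 0 i - torus_int (fun x => react (wave a x) * cosn i x)).

Let W := \sum_(i < n.+2) w i * cosn_mass i.
Let L := W + 2 * pi * (lam + K).

Let wm_ge0 i : 0 <= w i * cosn_mass i.
Proof. by rewrite mulr_ge0// ltW// cosn_mass_gt0. Qed.

Let W_ge (i : 'I_n.+2) : w i * cosn_mass i <= W.
Proof. by rewrite /W (bigD1 i)//= lerDl sumr_ge0. Qed.

Let W_gt0 : 0 < W.
Proof.
apply: lt_le_trans (W_ge (Ordinal (isT : (1 < n.+2)%N))).
by rewrite /= w1 mul1r cosn_mass_gt0.
Qed.

Let K_ge0 : 0 <= K.
Proof.
have := f_lip 1 0; rewrite subr0 normr1 mulr1; apply: le_trans.
exact: normr_ge0.
Qed.

Let lamK_gt0 : 0 < lam + K.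
Proof. by have := K_ge0; have := lam1; lra. Qed.

Let L_gt0 : 0 < L.
Proof. by rewrite ltr_wpDr// !mulr_ge0// ?pi_ge0// ltW. Qed.

Lemma energy_expansion a h :
  `|energy (a + h) - energy a - dotv (energy_gradient a) h| <= L / 2 * dotv h h.
Proof.
pose rem x := react_pot (wave a x + wave h x) - react_pot (wave a x)
              - react (wave a x) * wave h x.
have brem : bounded_measurable rem.
  apply: bm_sub; last by apply: bm_mul; [exact: bm_react | exact: bm_wave].
  apply: bm_sub; last exact: bm_pot.
  by apply: (bm_comp react_pot_continuous); apply: bm_add; exact: bm_wave.
have remI : torus_int rem = torus_int (fun x => react_pot (wave (a + h) x))
   - torus_int (fun x => react_pot (wave a x))
   - torus_int (fun x => react (wave a x) * wave h x).
  rewrite /rem -!torus_int_sub//; try exact: bm_pot.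
  - by apply: eq_torus_int => x; rewrite waveD.
  - by apply: bm_sub; exact: bm_pot.
  - by apply: bm_mul; [exact: bm_react | exact: bm_wave].
have E : energy (a + h) - energy a - dotv (energy_gradient a) h =
    2^-1 * (\sum_(i < n.+2) w i * cosn_mass i * h 0 i ^+ 2) - torus_int rem.
  rewrite remI torus_int_mul_cos_poly; last exact: bm_react.
  rewrite /energy /dotv.
  have -> : \sum_(i < n.+2) w i * cosn_mass i * (a + h) 0 i ^+ 2 =
    \sum_(i < n.+2) w i * cosn_mass i * a 0 i ^+ 2 +
    2 * \sum_(i < n.+2) w i * cosn_mass i * a 0 i * h 0 i +
    \sum_(i < n.+2) w i * cosn_mass i * h 0 i ^+ 2.
    rewrite mulr_sumr -!big_split /=; apply: eq_bigr => i _; rewrite mxE; ring.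
  have -> : \sum_i energy_gradient a 0 i * h 0 i =
    \sum_(i < n.+2) w i * cosn_mass i * a 0 i * h 0 i -
    \sum_(i < n.+2) coefs h i * torus_int (fun x => react (wave a x) * cosn i x).
    rewrite -sumrB; apply: eq_bigr => i _; rewrite mxE coefsE; ring.
  by field.
have remle : `|torus_int rem| <= (lam + K) / 2 * (2 * pi * dotv h h).
  apply: le_trans (torus_int_norm_le brem) _.
  apply: le_trans (_ : torus_int (fun x => (lam + K) / 2 * wave h x ^+ 2) <= _).
    apply: torus_int_le => [||x].
    - exact: bm_norm.
    - by apply: bm_scale; apply: bm_sqr; exact: bm_wave.
    - exact: (first_order_expansion react_pot_derive react_lip).
  have -> : torus_int (fun x => (lam + K) / 2 * wave h x ^+ 2) =
      (lam + K) / 2 * \sum_(i < n.+2) cosn_mass i * h 0 i ^+ 2.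
    rewrite torus_int_scale ?torus_int_wave_sqr//.
    by apply: bm_sqr; exact: bm_wave.
  apply: ler_wpM2l; first by rewrite divr_ge0// ltW.
  rewrite /dotv mulr_sumr; apply: ler_sum => i _.
  by rewrite -expr2 ler_wpM2r ?sqr_ge0 ?cosn_mass_le.
have quad0 : 0 <= \sum_(i < n.+2) w i * cosn_mass i * h 0 i ^+ 2.
  by apply: sumr_ge0 => i _; rewrite mulr_ge0 ?sqr_ge0.
have quadle : \sum_(i < n.+2) w i * cosn_mass i * h 0 i ^+ 2 <= W * dotv h h.
  rewrite /dotv mulr_sumr; apply: ler_sum => i _.
  by rewrite -expr2 ler_wpM2r ?sqr_ge0 ?W_ge.
rewrite E; apply: le_trans (ler_normB _ _) _.
rewrite ger0_norm ?mulr_ge0// /L.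
have -> : (W + 2 * pi * (lam + K)) / 2 * dotv h h =
  2^-1 * (W * dotv h h) + (lam + K) / 2 * (2 * pi * dotv h h) by field.
by rewrite lerD// ler_wpM2l.
Qed.

Lemma energy_continuous : continuous energy.
Proof.
move=> a.
apply: (@continuous_locally_lipschitz _ _ _ _ _
  (\sum_i `|energy_gradient a 0 i| + L / 2 * n.+2%:R)) => h h1.
have -> : energy (a + h) - energy a =
  dotv (energy_gradient a) h + (energy (a + h) - energy a - dotv (energy_gradient a) h) by ring.
apply: le_trans (ler_normD _ _) _; rewrite mulrDl lerD//.
  apply: le_trans (ler_norm_sum _ _ _) _; rewrite mulr_suml; apply: ler_sum => i _.
  by rewrite normrM ler_wpM2l// norm_coord_le.
apply: le_trans (energy_expansion a h) _; rewrite -[leRHS]mulrA.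
apply: ler_wpM2l; first by rewrite divr_ge0// ltW.
apply: le_trans (dotv_le_sqr_norm h) _; rewrite ler_wpM2l// expr2.
by rewrite -[leRHS]mulr1 ler_wpM2l.
Qed.

Lemma energy_gradient_continuous : continuous energy_gradient.
Proof.
move=> a.
apply: (@continuous_locally_lipschitz _ _ _ _ _
  (W + 2 * pi * ((lam + K) * n.+2%:R))) => h h1.
apply: norm_rV_le => [|i].
  by rewrite mulr_ge0// addr_ge0 ?mulr_ge0 ?pi_ge0 ?ltW.
rewrite !mxE.
have -> : w i * cosn_mass i * (a 0 i + h 0 i) -
    torus_int (fun x => react (wave (a + h) x) * cosn i x) -
    (w i * cosn_mass i * a 0 i - torus_int (fun x => react (wave a x) * cosn i x)) =
  w i * cosn_mass i * h 0 i - (torus_int (fun x => react (wave (a + h) x) * cosn i x)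
    - torus_int (fun x => react (wave a x) * cosn i x)) by ring.
have bmi b : bounded_measurable (fun x => react (wave b x) * cosn i x).
  by apply: bm_mul; [exact: bm_react | exact: bm_cosn].
rewrite -torus_int_sub//.
apply: le_trans (ler_normB _ _) _; rewrite mulrDl lerD//.
  rewrite normrM (ger0_norm (wm_ge0 i)).
  by rewrite ler_pM ?W_ge ?norm_coord_le.
rewrite -mulrA; apply: torus_int_norm_bound => [|x]; first exact: bm_sub.
rewrite -mulrBl normrM.
apply: le_trans (_ : `|react (wave (a + h) x) - react (wave a x)| * 1 <= _).
  by rewrite ler_wpM2l ?normr_cosn_le1.
rewrite mulr1; apply: le_trans (react_lip _ _) _.
by rewrite waveD (addrC (wave a x)) addrK -mulrA ler_wpM2l ?norm_wave_le// ltW.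
Qed.

(** Testing with constants: by superlinearity of [f], a bound on the mean of the
    reaction term bounds [wave a] in [L^1], hence each of its coefficients. *)
Lemma energy_gradient_bounded :
  bounded_set [set a | dotv (energy_gradient a) (energy_gradient a) <= 1].
Proof.
pose B := (1 + 2 * pi * C0) / lam / pi.
exists B; split; first exact: num_real.
move=> M BM a /= Da; apply: le_trans (ltW BM); have lam_gt1 := lam1.
have D0 : `|energy_gradient a 0 0| <= 1.
  apply: le_trans (norm_coord_le _ _) _.
  rewrite -(@ler_pXn2r _ 2%N)// ?nnegrE// expr1n.
  exact: le_trans (sqr_norm_le_dotv _) Da.
rewrite mxE /= w0 !mul0r sub0r normrN in D0.
have bf : bounded_measurable (fun x => f (wave a x)) by exact: (bm_comp cf (bm_wave a)).
have bw := bm_wave a; have baw := bm_norm bw.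
have I1 : torus_int (fun x => react (wave a x) * cosn 0 x) =
    lam * torus_int (wave a) + torus_int (fun x => f (wave a x)).
  under eq_torus_int do rewrite cosn0 mulr1 /react.
  by rewrite torus_int_add ?torus_int_scale//; exact: bm_scale.
rewrite I1 in D0.
have I2 : 2 * lam * torus_int (fun x => `|wave a x|) <=
    torus_int (fun x => f (wave a x)) + 2 * pi * C0.
  rewrite -torus_int_scale// -torus_int_cst -torus_int_add//; last exact: bm_cst.
  by apply: torus_int_le => //; [exact: bm_scale | apply: bm_add => //; exact: bm_cst].
have I3 := torus_int_norm_le bw.
have I4 : torus_int (fun x => `|wave a x|) <= (1 + 2 * pi * C0) / lam.
  rewrite ler_pdivlMr; last lra.
  move: D0 I3; rewrite !ler_norml => /andP[_ D0] /andP[I3 _].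
  have := ler_wpM2l (_ : 0 <= lam) I3; rewrite mulrN => /(_ _) I5.
  have {}I5 := I5 (ltW (lt_trans ltr01 lam_gt1)).
  lra.
have B0 : 0 <= B.
  rewrite /B divr_ge0 ?pi_ge0//; apply: le_trans I4.
  by apply: torus_int_ge0 => x.
apply: norm_rV_le => // i.
rewrite /B ler_pdivlMr ?pi_gt0//; apply: le_trans I4.
have : `|cosn_mass i * a 0 i| <= torus_int (fun x => `|wave a x|).
  have := torus_int_cos_poly_cosn n.+2 (coefs a) i; rewrite ltn_ord coefsE => <-.
  apply: le_trans (torus_int_norm_le _) _; first by apply: bm_mul => //; exact: bm_cosn.
  apply: torus_int_le => // [|x]; first by apply: bm_norm; apply: bm_mul => //; exact: bm_cosn.
  by rewrite normrM ler_piMr// normr_cosn_le1.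
apply: le_trans; rewrite normrM mulrC ler_wpM2r// ger0_norm ?cosn_mass_ge//.
by rewrite ltW// cosn_mass_gt0.
Qed.


Definition two_mode s t : V :=
  \row_(i < n.+2) (if i == 0%N :> nat then s else if i == 1%N :> nat then t else 0).

Lemma sum_two_mode (G : nat -> R -> R) s t : (forall i, G i 0 = 0) ->
  \sum_(i < n.+2) G i (two_mode s t 0 i) = G 0%N s + G 1%N t.
Proof.
move=> G0; rewrite !big_ord_recl big1 => [|i _]; last by rewrite mxE /= G0.
by rewrite !mxE /= addr0.
Qed.

Lemma wave_two_mode s t x : wave (two_mode s t) x = s + t * cosn 1 x.
Proof.
rewrite waveE (sum_two_mode (G := fun i y => y * cosn i x)) ?cosn0 ?mulr1// => i.
by rewrite mul0r.
Qed.

Lemma energy_two_mode s t : energy (two_mode s t) =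
  pi / 2 * t ^+ 2 - torus_int (fun x => react_pot (s + t * cosn 1 x)).
Proof.
rewrite /energy (sum_two_mode (G := fun i y => w i * cosn_mass i * y ^+ 2)) => [|i].
  under eq_torus_int do rewrite wave_two_mode.
  by rewrite w0 w1 !mul0r add0r mul1r /cosn_mass /=; field.
by rewrite expr0n mulr0.
Qed.

Lemma energy_constant s : energy (two_mode s 0) = - (2 * pi * react_pot s).
Proof.
rewrite energy_two_mode expr0n mulr0 sub0r.
by under eq_torus_int do rewrite mul0r addr0; rewrite torus_int_cst.
Qed.

Let bottom := two_mode (- c) 0.

Lemma energy_gradient_bottom : energy_gradient bottom = 0.
Proof.
apply/rowP => i; rewrite !mxE.
have -> : torus_int (fun x => react (wave bottom x) * cosn i x) = 0.
  under eq_torus_int do rewrite wave_two_mode mul0r addr0 /react f_c mulrN addNr mul0r.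
  by rewrite torus_int_cst mulr0.
by case: (nat_of_ord i) => [|[|k]] /=; rewrite ?w0 ?mul0r ?mulr0 subr0.
Qed.

(** As long as the wave stays below [- (c / 2)], the potential is quadratically
    below its maximum at [- c], pointwise. *)
Lemma energy_barrier a : n.+2%:R * `|a - bottom| <= c / 2 ->
  energy bottom + lam / 4 * pi * `|a - bottom| ^+ 2 <= energy a.
Proof.
set v := a - bottom => vc; have lam_gt1 := lam1.
have wa x : wave a x = - c + wave v x.
  by rewrite -[a in LHS](subrK bottom) addrC waveD wave_two_mode mul0r addr0.
have pot x : react_pot (wave a x) + lam / 4 * wave v x ^+ 2 <= react_pot (- c).
  have vx : wave v x <= c / 2 by apply: le_trans (ler_norm _) (le_trans (norm_wave_le _ _) vc).
  have -> : wave v x = wave a x + c by rewrite wa; ring.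
  by apply: react_pot_le_max; rewrite wa; lra.
have bv : bounded_measurable (fun x => lam / 4 * wave v x ^+ 2).
  by apply: bm_scale; apply: bm_sqr; exact: bm_wave.
have := torus_int_le (bm_add (bm_pot a) bv) (bm_cst _) pot.
rewrite torus_int_add ?torus_int_cst//.
have -> : torus_int (fun x => lam / 4 * wave v x ^+ 2) =
    lam / 4 * \sum_(i < n.+2) cosn_mass i * v 0 i ^+ 2.
  rewrite torus_int_scale ?torus_int_wave_sqr//.
  by apply: bm_sqr; exact: bm_wave.
have low : lam / 4 * (pi * `|v| ^+ 2) <= lam / 4 * \sum_(i < n.+2) cosn_mass i * v 0 i ^+ 2.
  apply: ler_wpM2l; first by lra.
  apply: le_trans (ler_wpM2l (pi_ge0 R) (sqr_norm_le_dotv v)) _.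
  rewrite /dotv mulr_sumr; apply: ler_sum => i _.
  by rewrite -expr2 ler_wpM2r ?sqr_ge0 ?cosn_mass_ge.
have quad : 0 <= 2^-1 * \sum_(i < n.+2) w i * cosn_mass i * a 0 i ^+ 2.
  by rewrite mulr_ge0// sumr_ge0// => i _; rewrite mulr_ge0 ?sqr_ge0.
rewrite energy_constant /energy; lra.
Qed.

(** The path that climbs out of the well at [- c].  It moves along the constants,
    except that it passes [0] on a detour through the first cosine mode: as
    [1 < lam], the energy is negative in the plane of both modes near [0]. *)
Definition detour s : V := two_mode s (Num.max 0 (r - `|s|)).

Lemma detour_continuous : continuous detour.
Proof.
move=> s; apply: (@continuous_locally_lipschitz _ _ _ _ _ 1) => h _.
rewrite mul1r; apply: norm_rV_le => // i; rewrite !mxE.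
case: ifP => _; first by rewrite addrC addKr.
case: ifP => _; last by rewrite subrr normr0.
have := ler_dist_dist (s + h) s; rewrite (addrC s) addrK.
rewrite !ler_norml => /andP[h1 h2].
by case: (leP 0 (r - `|h + s|)) => H1; case: (leP 0 (r - `|s|)) => H2; apply/andP; split;
  have := normr_ge0 h; lra.
Qed.

Lemma energy_detour s : - c <= s -> energy (detour s) <= - ((lam - 1) * pi / 8 * r ^+ 2).
Proof.
have lam_gt1 := lam1; have pi0 := pi_gt0 R; have r2 := sqr_ge0 r.
have pr2 : 0 <= pi * r ^+ 2 by rewrite mulr_ge0// ltW.
have lpr2 : 0 <= (lam - 1) * (pi * r ^+ 2) by rewrite mulr_ge0//; lra.
move=> cs; rewrite /detour; case: (leP 0 (r - `|s|)) => rs; last first.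
  rewrite energy_constant lerN2.
  have rs' : r <= `|s| by rewrite -subr_le0 ltW.
  have H := react_pot_far cs rs'.
  have := ler_wpM2l (ltW pi0) H; lra.
set t := r - `|s|.
have ux x : `|s + t * cosn 1 x| <= r.
  apply: le_trans (ler_normD _ _) _; rewrite normrM (ger0_norm rs).
  have := ler_wpM2l rs (normr_cosn_le1 1 x); rewrite /t; lra.
have bw : bounded_measurable (fun x => s + t * cosn 1 x).
  by apply: bm_add; [exact: bm_cst | apply: bm_scale; exact: bm_cosn].
have bww : bounded_measurable (fun x => (lam + 1) / 4 * (s + t * cosn 1 x) ^+ 2).
  by apply: bm_scale; exact: bm_sqr.
have := torus_int_le bww (bm_comp react_pot_continuous bw) (fun x => react_pot_small (ux x)).
rewrite energy_two_mode.
have -> : torus_int (fun x => (lam + 1) / 4 * (s + t * cosn 1 x) ^+ 2) =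
    (lam + 1) / 4 * (2 * pi * s ^+ 2 + pi * t ^+ 2).
  under eq_torus_int do rewrite -wave_two_mode.
  rewrite torus_int_scale; last by apply: bm_sqr; exact: bm_wave.
  rewrite torus_int_wave_sqr (sum_two_mode (G := fun i y => cosn_mass i * y ^+ 2)) => [|i].
    by rewrite /cosn_mass /=.
  by rewrite expr0n mulr0.
(* On the detour [`|s| + t = r], so the point stays away from the origin. *)
have split : r ^+ 2 <= 2 * (s ^+ 2 + t ^+ 2).
  have -> : s ^+ 2 = `|s| ^+ 2 by rewrite real_normK ?num_real.
  have -> : r = `|s| + t by rewrite /t; ring.
  by rewrite -subr_ge0; have := sqr_ge0 (`|s| - t); lra.
have H : (lam - 1) * pi / 8 * r ^+ 2 <= (lam - 1) * pi / 8 * (2 * (s ^+ 2 + t ^+ 2)).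
  by apply: ler_wpM2l => //; rewrite divr_ge0// mulr_ge0//; lra.
have ps : 0 <= pi * s ^+ 2 by rewrite mulr_ge0 ?sqr_ge0// ltW.
have lps : 0 <= (lam - 1) * (pi * s ^+ 2) by rewrite mulr_ge0//; lra.
rewrite /comp /=; lra.
Qed.

(** The second conclusion is the value of the energy at a critical point: there,
    the quadratic part equals the reaction term tested with [u].  The third
    excludes the bottom of the well: if [u <= - (c / 2)], then testing with
    [u + c] forces [u = - c], at whose energy the mountain pass does not lie. *)
Theorem galerkin_mountain_pass : exists a : nat -> R,
  let u := cos_poly n.+2 a in
  [/\ forall i, (i < n.+2)%N ->
        w i * cosn_mass i * a i = torus_int (fun x => react (u x) * cosn i x),
      torus_int (fun x => f (u x) * u x / 2 - F (u x)) <= - ((lam - 1) * pi / 8 * r ^+ 2) &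
      ~ (forall x, u x <= - (c / 2))].
Proof.
have lam_gt1 := lam1; have pi0 := pi_gt0 R; have c_gt0 := c0; have r_gt0 := r0.
(* On the sphere of radius [rho] the wave is within [c / 2] of [- c]. *)
pose rho := c / 2 / n.+2%:R.
have rho0 : 0 < rho by rewrite !divr_gt0.
have rhoE : n.+2%:R * rho = c / 2 by rewrite /rho mulrC divfK.
(* Large enough for the energy of the constant [T] to lie below the well. *)
pose T := r + 1 + 2 * `|react_pot (- c)|.
have pot_c := ler_norm (react_pot (- c)).
have T1 : 1 <= T by rewrite /T; have := normr_ge0 (react_pot (- c)); lra.
have cT : - c <= T by lra.
have rT : r <= `|T|.
  by rewrite ger0_norm; rewrite /T; have := normr_ge0 (react_pot (- c)); lra.
have rnc : r - `|- c| <= 0 by rewrite normrN gtr0_norm//; have := rc; lra.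
have bottomE : detour (- c) = bottom by rewrite /detour max_l.
have endE : detour T = two_mode T 0 by rewrite /detour max_l// subr_le0.
have [|||||||||a [Da Ea_gt Ea_le]] := @mountain_pass R n.+1 energy energy_gradient L bottom
    (detour T) (detour @` `[- c, T]) rho (lam / 4 * pi * rho ^+ 2)
    (- ((lam - 1) * pi / 8 * r ^+ 2)) 1 L_gt0 _ energy_continuous energy_gradient_continuous
    ltr01 energy_gradient_bounded energy_gradient_bottom rho0.
- move=> a h; have := energy_expansion a h; rewrite ler_norml => /andP[_]; lra.
- by rewrite !mulr_gt0 ?invr_gt0 ?exprn_gt0//; lra.
- move=> a arho; apply: le_trans (energy_barrier _); last by rewrite -rhoE ler_wpM2l.
  by rewrite lerDl !mulr_ge0 ?sqr_ge0 ?invr_ge0// ltW//; lra.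
- by move=> a arho; rewrite -arho; apply: energy_barrier; rewrite arho rhoE.
- apply: connected_continuous_connected; first exact: segment_connected.
  exact/continuous_subspaceT/detour_continuous.
- by exists (- c); rewrite //= in_itv /= lexx.
- by exists T; rewrite //= in_itv /= lexx andbT.
- rewrite endE !energy_constant ltrN2 ltr_pM2l ?mulr_gt0//.
  apply: lt_le_trans (react_pot_ge_sqr (le_trans ler01 T1)).
  have TT : T <= T ^+ 2 by rewrite expr2 ler_peMl//; lra.
  have lTT : T ^+ 2 / 2 <= lam / 2 * T ^+ 2.
    by rewrite mulrC ler_wpM2r ?sqr_ge0//; lra.
  have : 2 * react_pot (- c) < T by rewrite /T; lra.
  lra.
- by move=> _ [s + <-]; rewrite /= in_itv /= => /andP[cs _]; exact: energy_detour.
pose u := wave a.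
have crit i : (i < n.+2)%N -> w i * cosn_mass i * coefs a i =
    torus_int (fun x => react (u x) * cosn i x).
  move=> i_lt; have /rowP/(_ (Ordinal i_lt)) := Da; rewrite !mxE => /eqP.
  by rewrite subr_eq0 -coefsE => /eqP.
have bu : bounded_measurable u by exact: bm_wave.
have bf : bounded_measurable (fun x => f (u x)) by exact: (bm_comp cf bu).
have bF : bounded_measurable (fun x => F (u x)) by exact: (bm_comp F_continuous bu).
have quadE : \sum_(i < n.+2) w i * cosn_mass i * a 0 i ^+ 2 =
    torus_int (fun x => react (u x) * u x).
  rewrite torus_int_mul_cos_poly; last exact: bm_react.
  by apply: eq_bigr => i _; rewrite -crit// coefsE; ring.
exists (coefs a); split => //.
  apply: le_trans Ea_le; rewrite /energy quadE.
  rewrite -torus_int_scale; last by apply: bm_mul => //; exact: bm_react.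
  rewrite -torus_int_sub; last exact: bm_pot; last first.
    by apply: bm_scale; apply: bm_mul => //; exact: bm_react.
  rewrite le_eqVlt; apply/orP; left; apply/eqP; apply: eq_torus_int => x.
  rewrite /react /react_pot -/(wave a) -/u; set y := u x; by field.
move=> u_le.
pose v x := u x + c.
have bv : bounded_measurable v by apply: bm_add => //; exact: bm_cst.
have sgn x : react (u x) * u x + c * react (u x) <= - (lam / 2) * (v x * v x).
  have -> : react (u x) * u x + c * react (u x) = (u x + c) * react (u x) by ring.
  by rewrite -expr2; exact: react_sign (u_le x).
have mean0 : torus_int (fun x => react (u x)) = 0.
  have := crit 0%N isT; rewrite w0 !mul0r => /esym <-.
  by apply: eq_torus_int => x; rewrite cosn0 mulr1.
have bru : bounded_measurable (fun x => react (u x) * u x).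
  by apply: bm_mul => //; exact: bm_react.
have := torus_int_le (bm_add bru (bm_scale c (bm_react a))) (bm_scale _ (bm_mul bv bv)) sgn.
rewrite torus_int_add//; last by apply: bm_scale; exact: bm_react.
rewrite !torus_int_scale//; try exact: bm_mul; try exact: bm_react.
rewrite mean0 mulr0 addr0 -quadE => quad_le.
have quad_ge : 0 <= \sum_(i < n.+2) w i * cosn_mass i * a 0 i ^+ 2.
  by apply: sumr_ge0 => i _; rewrite mulr_ge0 ?sqr_ge0.
have vE x : v x = wave (a - bottom) x.
  have := waveD (a - bottom) bottom x; rewrite subrK wave_two_mode mul0r addr0.
  by rewrite /v /u => ->; rewrite addrNK.
have : lam / 2 * torus_int (fun x => v x * v x) <= 0 by lra.
rewrite pmulr_rle0; last lra.
under eq_torus_int do rewrite -expr2 vE.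
rewrite torus_int_wave_sqr => dist_le.
have : pi * `|a - bottom| ^+ 2 <= 0.
  apply: le_trans dist_le.
  apply: le_trans (ler_wpM2l (pi_ge0 R) (sqr_norm_le_dotv (a - bottom))) _.
  rewrite /dotv mulr_sumr; apply: ler_sum => i _.
  by rewrite -expr2 ler_wpM2r ?sqr_ge0 ?cosn_mass_ge.
rewrite pmulr_rle0// => dist0.
have : `|a - bottom| ^+ 2 == 0 by rewrite eq_le dist0 sqr_ge0.
rewrite sqrf_eq0 normr_eq0 subr_eq0 => /eqP ab.
by move: Ea_gt; rewrite ab ltxx.
Qed.

End FixedDimension.

End Galerkin.

(** * A priori bounds *)

Section CoefficientTails.
Context {R : realType}.
Implicit Types (a b : nat -> R) (m n N : nat) (K B C : R).

Lemma sum_truncatedE (G : nat -> R) N M :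
  \sum_(i < M) (if (i < N)%N then G i else 0) = \sum_(i < minn M N) G i.
Proof.
elim: M => [|M IH]; first by rewrite min0n !big_ord0.
rewrite big_ord_recr /= IH; case: ltnP => MN.
  by rewrite (minn_idPl MN) big_ord_recr.
by rewrite addr0 (minn_idPr (leqW MN)).
Qed.

Lemma sum_truncated_le (G : nat -> R) N M : (forall i, 0 <= G i) ->
  \sum_(i < M) (if (i < N)%N then G i else 0) <= \sum_(i < N) G i.
Proof.
move=> G0; rewrite sum_truncatedE -!(big_mkord xpredT G).
rewrite [leRHS](@big_cat_nat _ _ _ (minn M N))//= ?geq_minr//.
by rewrite lerDl; apply: sumr_ge0.
Qed.

Lemma harmonic_sum_le_ln m : (0 < m)%N -> \sum_(i < m.+1) i%:R^-1 <= 1 + ln m%:R :> R.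
Proof.
elim: m => // -[_ _|m IH _].
  by rewrite !big_ord_recr big_ord0 /= invr0 !add0r ln1 addr0 invr1.
rewrite big_ord_recr /=; apply: le_trans (lerD (IH isT) (lexx _)) _.
rewrite -addrA lerD2l -lerBrDl.
have m1 : 0 < m.+1%:R :> R by rewrite ltr0n.
have m2 : 0 < m.+2%:R :> R by rewrite ltr0n.
rewrite -opprB lerNr -ln_div ?posrE//.
have -> : m.+1%:R / m.+2%:R = 1 + - m.+2%:R^-1 :> R.
  rewrite -{1}[m.+1%:R](addrK 1) natr1 mulrBl divff ?gt_eqF// mul1r.
  by [].
by apply: le_ln1Dx; rewrite ltrN2 invf_lt1// ltr1n.
Qed.

Lemma sum_inv_sqr_tail m N : (0 < m)%N ->
  \sum_(i < N.+1) (if (m < i)%N then i%:R ^- 2 else 0) <= m%:R^-1 - (maxn m N)%:R^-1 :> R.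
Proof.
move=> m0; elim: N => [|N IH].
  by rewrite big_ord_recr big_ord0 /= maxn0 subrr addr0.
rewrite big_ord_recr /=; case: ifP => mN; last first.
  rewrite addr0; apply: le_trans IH _.
  have Nm : (N.+1 <= m)%N by rewrite leqNgt mN.
  by rewrite (maxn_idPl Nm) (maxn_idPl (ltnW Nm)).
rewrite ltnS in mN; apply: le_trans (lerD IH (lexx _)) _.
rewrite (maxn_idPr mN) (maxn_idPr (leqW mN)) -addrA lerD2l -lerBrDl opprK.
have N0 : 0 < N%:R :> R by rewrite ltr0n; exact: leq_trans mN.
have N1 : 0 < N.+1%:R :> R by rewrite ltr0n.
have -> : - N.+1%:R^-1 + N%:R^-1 = (N%:R * N.+1%:R)^-1 :> R.
  have E : N.+1%:R = N%:R + 1 :> R by rewrite natr1.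
  move: N0 N1; rewrite E; move: (N%:R) => y y0 y1.
  by field; rewrite !gt_eqF.
by rewrite lef_pV2 ?posrE ?mulr_gt0 ?exprn_gt0// expr2 ler_wpM2r ?ler_nat// ltW.
Qed.

(** The inequality of arithmetic and geometric means for [K / i] and [i * `|a i|]. *)
Lemma coefs_tail_le a m N K B : (0 < m)%N -> 0 < K ->
  \sum_(i < N) (i%:R * a i) ^+ 2 <= B ->
  \sum_(i < N) (if (m < i)%N then `|a i| else 0) <= K / 2 / m%:R + B / (2 * K).
Proof.
move=> m0 K0 aB.
apply: le_trans (_ : K / 2 * \sum_(i < N) (if (m < i)%N then i%:R ^- 2 else 0) +
    \sum_(i < N) (i%:R * a i) ^+ 2 / (2 * K) <= _).
  rewrite mulr_sumr -big_split /=; apply: ler_sum => i _; case: ifP => mi; last first.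
    by rewrite mulr0 add0r divr_ge0 ?sqr_ge0 ?mulr_ge0// ltW.
  have i0 : 0 < i%:R :> R by rewrite ltr0n; exact: leq_ltn_trans mi.
  rewrite -subr_ge0.
  have -> : K / 2 * i%:R ^- 2 + (i%:R * a i) ^+ 2 / (2 * K) - `|a i| =
      (K / i%:R - i%:R * `|a i|) ^+ 2 / (2 * K).
    have -> : (i%:R * a i) ^+ 2 = (i%:R * `|a i|) ^+ 2.
      by rewrite !exprMn real_normK ?num_real.
    by field; rewrite !gt_eqF.
  by rewrite divr_ge0 ?sqr_ge0 ?mulr_ge0// ltW.
rewrite lerD//; last by rewrite -mulr_suml ler_wpM2r// invr_ge0 mulr_ge0// ltW.
apply: ler_wpM2l; first by rewrite divr_ge0// ltW.
case: N {aB} => [|N]; first by rewrite big_ord0 invr_ge0.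
by apply: le_trans (sum_inv_sqr_tail N m0) _; rewrite gerBl invr_ge0.
Qed.

(** Harmonic decay is used up to the frequency [m], the weighted square sum
    beyond it. *)
Lemma sum_coefs_le_ln a m N C B : (0 < m)%N -> 0 <= C ->
  (forall i, (i < N)%N -> i%:R * `|a i| <= C) ->
  \sum_(i < N) (i%:R * a i) ^+ 2 <= B ->
  \sum_(i < N) `|a i| <= `|a 0%N| + C * (1 + ln m%:R) + (1 + B / m%:R) / 2.
Proof.
move=> m0 C0 aC aB; have m_gt0 : 0 < m%:R :> R by rewrite ltr0n.
have tail := coefs_tail_le m0 m_gt0 aB.
have head : \sum_(i < N) (if (i <= m)%N then i%:R^-1 else 0) <= 1 + ln m%:R :> R.
  have ln0 : 0 <= ln m%:R :> R by rewrite ln_ge0// ler1n.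
  rewrite (sum_truncatedE (fun i => i%:R^-1) m.+1); have := geq_minr N m.+1; case: (minn N m.+1) => [_|[_|k km]].
  - by rewrite big_ord0; lra.
  - by rewrite big_ord_recr big_ord0 /= invr0; lra.
  apply: le_trans (harmonic_sum_le_ln _) _ => //.
  by rewrite lerD2l ler_ln ?posrE ?ltr0n// ler_nat.
apply: le_trans (_ : \sum_(i < N) ((if i == 0%N :> nat then `|a 0%N| else 0) +
   (C * (if (i <= m)%N then i%:R^-1 else 0) + (if (m < i)%N then `|a i| else 0))) <= _).
  apply: ler_sum => i _; case: (posnP i) => [->|i0]; first by rewrite leq0n invr0 mulr0 /= !addr0.
  rewrite add0r; case: ltnP => mi; first by rewrite mulr0 add0r.
  by rewrite addr0 ler_pdivlMr ?ltr0n// mulrC aC.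
rewrite !big_split /= -mulr_sumr.
have first : \sum_(i < N) (if i == 0%N :> nat then `|a 0%N| else 0) <= `|a 0%N|.
  case: N {aC aB tail head} => [|N]; first by rewrite big_ord0.
  by rewrite big_ord_recl /= big1 ?addr0// => i _; rewrite /bump.
rewrite -!addrA lerD// lerD//; first exact: ler_wpM2l.
apply: le_trans tail _; rewrite le_eqVlt; apply/orP; left; apply/eqP.
by field; rewrite gt_eqF.
Qed.

End CoefficientTails.

Section APriori.
Context {R : realType}.

(** Testing the equation with constants bounds the reaction term in [L^1], hence
    each coefficient by a multiple of [i^-1].  The [L^2] norm of the reaction
    term is at most a power of the total mass [S] of the coefficients, while the
    coefficients are harmonic up to a frequency that is polynomial in [S] and
    square summable with weight beyond it.  So [S] is at most affine in [ln S]. *)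
Theorem a_priori_bound (lam p C0 : R) : 0 < lam -> 1 <= p -> 0 <= C0 -> exists B : R,
  forall (w : nat -> R) (f : R -> R) (N : nat) (a : nat -> R),
    (forall i, i%:R <= w i) -> w 0%N = 0 -> (0 < N)%N ->
    continuous f -> (forall t, 0 <= f t) -> (forall t, f t <= `|t| `^ p) ->
    (forall t, 2 * lam * `|t| <= f t + C0) ->
    (forall i, (i < N)%N -> w i * cosn_mass i * a i =
       torus_int (fun x => (lam * cos_poly N a x + f (cos_poly N a x)) * cosn i x)) ->
    \sum_(i < N) `|a i| <= B /\ \sum_(i < N) (i%:R * a i) ^+ 2 <= B.
Proof.
move=> lam0 p1 C00; have pi0 := pi_gt0 R.
pose A := 2 * pi * C0.
have A0 : 0 <= A by rewrite /A !mulr_ge0// ltW.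
pose C2 := 2 * A / pi.
have C20 : 0 <= C2 by rewrite divr_ge0 ?mulr_ge0// ltW.
pose C5 := (2 * lam * A + 2 * A) / pi.
have C50 : 0 <= C5.
  by apply: divr_ge0; [apply: addr_ge0; rewrite !mulr_ge0// ltW | exact: ltW].
pose C6 := 1 + A / lam / pi + C2 * (1 + ln (C5 + 1)) + 1.
pose C8 := C6 + C2 * p * 2.
exists (Num.max (C8 ^+ 2) (C5 * (C8 ^+ 2) `^ p)) => w f N a iw w0 N0 cf f0 fp fsup crit.
set u := cos_poly N a in crit.
have bu : bounded_measurable u by exact: bm_cos_poly.
have bau := bm_norm bu.
have bf : bounded_measurable (fun x => f (u x)) by exact: (bm_comp cf bu).
have bg : bounded_measurable (fun x => lam * u x + f (u x)).
  by apply: bm_add => //; exact: bm_scale.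
pose U := torus_int (fun x => `|u x|).
pose Phi := torus_int (fun x => f (u x)).
have U0 : 0 <= U by apply: torus_int_ge0 => x.
have Phi_le : Phi <= lam * U.
  have := crit 0%N N0; rewrite w0 !mul0r => /esym.
  under eq_torus_int do rewrite cosn0 mulr1.
  rewrite torus_int_add ?torus_int_scale//; last exact: bm_scale.
  rewrite -/Phi => E; have := torus_int_norm_le bu; rewrite -/U ler_norml => /andP[h _].
  have := ler_wpM2l (ltW lam0) h; lra.
have lamU : lam * U <= A.
  have : 2 * lam * U <= Phi + A.
    rewrite -torus_int_scale// /A -torus_int_cst -torus_int_add//; last exact: bm_cst.
    by apply: torus_int_le => //; [exact: bm_scale | apply: bm_add => //; exact: bm_cst].
  lra.
have PhiA : Phi <= A by lra.
have coef i : (i < N)%N -> `|w i * cosn_mass i * a i| <= 2 * A.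
  move=> iN; rewrite crit//.
  have bgc : bounded_measurable (fun x => (lam * u x + f (u x)) * cosn i x).
    by apply: bm_mul => //; exact: bm_cosn.
  apply: le_trans (torus_int_norm_le bgc) _.
  apply: le_trans (_ : torus_int (fun x => lam * `|u x| + f (u x)) <= _).
    apply: torus_int_le; [exact: bm_norm | by apply: bm_add => //; exact: bm_scale |].
    move=> x; rewrite normrM; apply: le_trans (_ : `|lam * u x + f (u x)| * 1 <= _).
      by rewrite ler_wpM2l ?normr_cosn_le1.
    rewrite mulr1; apply: le_trans (ler_normD _ _) _.
    by rewrite normrM (gtr0_norm lam0) (ger0_norm (f0 _)).
  rewrite torus_int_add ?torus_int_scale//; last exact: bm_scale.
  rewrite -/U -/Phi; lra.
have ia i : (i < N)%N -> i%:R * `|a i| <= C2.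
  move=> iN; rewrite ler_pdivlMr//; apply: le_trans (coef i iN).
  have w_ge0 : 0 <= w i by apply: le_trans (iw i).
  have m_ge0 := ltW (cosn_mass_gt0 (R := R) i).
  rewrite !normrM (ger0_norm w_ge0) (ger0_norm m_ge0) mulrAC.
  by rewrite ler_wpM2r// ler_pM ?cosn_mass_ge// ltW.
have a0 : `|a 0%N| <= A / lam / pi.
  have H : `|cosn_mass 0 * a 0%N| <= U.
    have := torus_int_cos_poly_cosn N a 0; rewrite N0 => <-.
    apply: le_trans (torus_int_norm_le _) _; first by apply: bm_mul => //; exact: bm_cosn.
    apply: torus_int_le => // [|x]; first by apply: bm_norm; apply: bm_mul => //; exact: bm_cosn.
    by rewrite cosn0 mulr1.
  rewrite ler_pdivlMr// ler_pdivlMr//; apply: le_trans lamU.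
  rewrite mulrC ler_wpM2l ?(ltW lam0)//; apply: le_trans H.
  rewrite normrM mulrC ler_wpM2r// (gtr0_norm (cosn_mass_gt0 _)).
  exact: cosn_mass_ge.
pose S := 1 + \sum_(i < N) `|a i|.
have S1 : 1 <= S by rewrite lerDl sumr_ge0.
have uS x : `|u x| <= S.
  by apply: le_trans (normr_cos_poly_le _ _ _) _; rewrite lerDr.
have Sp : S <= S `^ p by rewrite -[leLHS]powRr1 ?ler_powR// (le_trans ler01).
have sqr : \sum_(i < N) (i%:R * a i) ^+ 2 <= C5 * S `^ p.
  pose b i := torus_int (fun x => (lam * u x + f (u x)) * cosn i x) / cosn_mass i.
  have bb i : torus_int (fun x => (lam * u x + f (u x)) * cosn i x) = cosn_mass i * b i.
    by rewrite /b mulrC divfK// gt_eqF// cosn_mass_gt0.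
  have := bessel N bg bb => bes.
  have wab i : (i < N)%N -> b i = w i * a i.
    by move=> iN; rewrite /b -crit// mulrAC mulfK// gt_eqF// cosn_mass_gt0.
  have low : pi * \sum_(i < N) (i%:R * a i) ^+ 2 <= \sum_(i < N) cosn_mass i * b i ^+ 2.
    rewrite mulr_sumr; apply: ler_sum => i _; rewrite wab//.
    apply: ler_pM; [exact: ltW | exact: sqr_ge0 | exact: cosn_mass_ge |].
    rewrite !exprMn; apply: ler_wpM2r; first exact: sqr_ge0.
    by rewrite lerXn2r ?nnegrE// (le_trans _ (iw i)).
  have up : torus_int (fun x => (lam * u x + f (u x)) ^+ 2) <=
      (2 * lam * A + 2 * A) * S `^ p.
    apply: le_trans (_ : torus_int (fun x => 2 * lam ^+ 2 * S * `|u x| + 2 * S `^ p * f (u x)) <= _).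
      apply: torus_int_le.
      - exact: bm_sqr.
      - by apply: bm_add; exact: bm_scale.
      move=> x; have fx := f0 (u x).
      have ff : f (u x) * f (u x) <= S `^ p * f (u x).
        rewrite ler_wpM2r//; apply: le_trans (fp _) _.
        apply: ge0_ler_powR; rewrite ?nnegrE//; last exact: le_trans ler01 S1.
        exact: le_trans ler01 p1.
      have uu : u x ^+ 2 <= S * `|u x|.
        by rewrite -real_normK ?num_real// expr2 ler_wpM2r.
      have luu := ler_wpM2l (sqr_ge0 lam) uu.
      have := sqr_ge0 (lam * u x - f (u x)); lra.
    rewrite torus_int_add; try exact: bm_scale.
    rewrite !torus_int_scale// -/U -/Phi [leRHS]mulrDl; apply: lerD.
      have -> : 2 * lam ^+ 2 * S * U = 2 * lam * (lam * U) * S by ring.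
      rewrite ler_pM ?mulr_ge0 ?(ltW lam0) ?(le_trans ler01 S1)//.
      by rewrite ler_wpM2l// mulr_ge0// ltW.
    by rewrite mulrAC ler_wpM2r ?powR_ge0// ler_wpM2l.
  rewrite /C5 mulrAC ler_pdivlMr// mulrC; apply: le_trans low (le_trans bes _).
  exact: up.
(* The frequency beyond which the weighted square sum contributes at most [1]. *)
pose m := (Num.truncn (C5 * S `^ p)).+1.
have m0 : (0 < m)%N by [].
have Q0 : 0 <= C5 * S `^ p by rewrite mulr_ge0// powR_ge0.
have Sp1 : 1 <= S `^ p by apply: le_trans Sp.
have mlow : C5 * S `^ p < m%:R by exact: Num.Theory.truncnS_gt.
have mup : m%:R <= (C5 + 1) * S `^ p.
  rewrite mulrDl mul1r -natr1 lerD//.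
  by rewrite Num.Theory.truncn_le.
have m_gt0 : 0 < m%:R :> R by rewrite ltr0n.
have S_gt0 : 0 < S by apply: lt_le_trans S1.
have lnm : ln m%:R <= ln (C5 + 1) + p * ln S.
  have C51 : 0 < C5 + 1 by apply: ltr_wpDl.
  rewrite -ln_powR -lnM ?posrE ?powR_gt0//.
  by rewrite ler_ln ?posrE// mulr_gt0// powR_gt0.
have := sum_coefs_le_ln m0 C20 ia sqr.
have -> : \sum_(i < N) `|a i| = S - 1 by rewrite /S; ring.
have tail : C5 * S `^ p / m%:R <= 1 by rewrite ler_pdivrMr// mul1r ltW.
have lnS : ln S <= 2 * (Num.sqrt S).
  have q0 : 0 < Num.sqrt S by rewrite sqrtr_gt0.
  have -> : ln S = 2 * ln (Num.sqrt S).
    by rewrite -{1}(sqr_sqrtr (ltW S_gt0)) lnXn// mulr_natl.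
  apply: ler_wpM2l => //.
  have := @le_ln1Dx R (Num.sqrt S - 1); rewrite (addrC 1) subrK => H.
  have : ln (Num.sqrt S) <= Num.sqrt S - 1 by apply: H; lra.
  lra.
move=> main.
have SC6 : S <= C6 + C2 * p * (2 * Num.sqrt S).
  have H1 := ler_wpM2l C20 lnm.
  have H2 : C2 * p * ln S <= C2 * p * (2 * Num.sqrt S).
    by rewrite ler_wpM2l// mulr_ge0// (le_trans ler01).
  rewrite /C6; lra.
have sq1 : 1 <= Num.sqrt S by rewrite -sqrtr1 ler_wsqrtr.
have C60 : 0 <= C6.
  have : 0 <= A / lam / pi by rewrite !divr_ge0// ltW.
  have : 0 <= C2 * (1 + ln (C5 + 1)).
    rewrite mulr_ge0// addr_ge0// ln_ge0//; lra.
  rewrite /C6; lra.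
have sqC8 : Num.sqrt S <= C8.
  have : Num.sqrt S * Num.sqrt S <= C8 * Num.sqrt S.
    rewrite -expr2 sqr_sqrtr ?(ltW S_gt0)//; apply: le_trans SC6 _.
    have := ler_wpM2l C60 sq1; rewrite /C8; lra.
  by rewrite ler_pM2r// (lt_le_trans ltr01).
have SC8 : S <= C8 ^+ 2.
  rewrite -(sqr_sqrtr (ltW S_gt0)) lerXn2r ?nnegrE ?sqrtr_ge0//.
  exact: le_trans sqC8.
split; rewrite le_max.
  by apply/orP; left; apply: le_trans SC8; rewrite gerBl.
apply/orP; right; apply: le_trans sqr _; apply: ler_wpM2l => //.
apply: ge0_ler_powR; rewrite ?nnegrE ?sqr_ge0 ?(ltW S_gt0)//.
exact: le_trans ler01 p1.
Qed.

End APriori.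

(** * Compactness of families of cosine series *)

Section Compactness.
Context {R : realType}.
Implicit Types (a l : nat -> R) (m n N M : nat).

Lemma bounded_cvg_ultra (U : set_system nat) (v : nat -> R) (B : R) :
  UltraFilter U -> (forall N, `|v N| <= B) -> exists l : R, v @ U --> l.
Proof.
move=> UU vB.
have FF : ProperFilter (v @ U) by exact: fmap_proper_filter.
have inB : (v @ U) `[- B, B]%classic.
  by rewrite /fmap /=; apply: filterE => N; rewrite /= in_itv /= -ler_norml.
have [l [_ cl]] := @segment_compact R (- B) B _ FF inB.
exists l => W Wl; have [//|UnW] := in_ultra_setVsetC (v @^-1` W) UU.
have vnW : (v @ U) (~` W) by [].
by have [y [nWy Wy]] := cl _ _ vnW Wl.
Qed.

(** [coefs_tail_le] with the balanced choice [K = Num.sqrt m]. *)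
Lemma coefs_tail_bound a B : (forall N, \sum_(i < N) (i%:R * a i) ^+ 2 <= B) ->
  forall m N, (0 < m)%N -> \sum_(i < N) (if (m < i)%N then `|a i| else 0) <=
    (1 + B) / Num.sqrt m%:R.
Proof.
move=> aB m N m0; have sm : 0 < Num.sqrt m%:R :> R by rewrite sqrtr_gt0 ltr0n.
apply: le_trans (coefs_tail_le m0 sm (aB N)) _.
have mE : m%:R = Num.sqrt m%:R ^+ 2 :> R by rewrite sqr_sqrtr.
rewrite [X in _ / 2 / X]mE.
have -> : Num.sqrt m%:R / 2 / Num.sqrt m%:R ^+ 2 + B / (2 * Num.sqrt m%:R) =
    (1 + B) / Num.sqrt m%:R - (1 + B) / Num.sqrt m%:R / 2 :> R.
  by field; rewrite gt_eqF.
have B0 : 0 <= B by apply: le_trans (aB 0%N); rewrite big_ord0.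
by rewrite gerBl; apply: divr_ge0 => //; apply: divr_ge0; [apply: addr_ge0 | apply: ltW].
Qed.

(** The weight [i ^+ 2] makes the tails uniformly small, so convergence of each
    coefficient along an ultrafilter is convergence in [l^1]. *)
Lemma coefs_compact (alpha : nat -> nat -> R) (B : R) :
  (forall N i, `|alpha N i| <= B) ->
  (forall N M, \sum_(i < M) (i%:R * alpha N i) ^+ 2 <= B) ->
  exists2 l : nat -> R, (forall M, \sum_(i < M) (i%:R * l i) ^+ 2 <= B) &
    forall (e : R) N0, 0 < e -> exists2 N, (N0 <= N)%N &
      forall M, \sum_(i < M) `|alpha N i - l i| <= e.
Proof.
move=> aB wB.
have [U [UU ooU]] := @ultraFilterLemma nat \oo _.
have FU : ProperFilter U by exact: ultra_proper.
have [l lim] : exists l : nat -> R, forall i, (fun N => alpha N i) @ U --> l i.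
  have /choice[l lim] : forall i, exists li : R, (fun N => alpha N i) @ U --> li.
    by move=> i; apply: (@bounded_cvg_ultra _ _ B) => // N; exact: aB.
  by exists l.
have lB M : \sum_(i < M) (i%:R * l i) ^+ 2 <= B.
  apply: (@closed_cvg _ _ U _ (fun N => \sum_(i < M) (i%:R * alpha N i) ^+ 2)
    (fun y => y <= B)).
  - exact: closed_le.
  - by apply: filterE => N; exact: wB.
  - apply: cvg_big => [|i _]; first exact: add_continuous.
    rewrite expr2; under eq_cvg do rewrite expr2.
    by apply: cvgM; apply: cvgM; (exact: cvg_cst || exact: lim).
exists l => // e N0 e0.
have B0 : 0 <= B by apply: le_trans (aB 0%N 0%N).
have [m m0 mtail] : exists2 m, (0 < m)%N & (1 + B) / Num.sqrt m%:R <= e / 3.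
  pose y := (1 + B) / (e / 3).
  have y0 : 0 < y by rewrite !divr_gt0//; lra.
  exists (Num.truncn (y ^+ 2)).+1 => //.
  rewrite ler_pdivrMr ?sqrtr_gt0 ?ltr0n//.
  have : y <= Num.sqrt (Num.truncn (y ^+ 2)).+1%:R.
    rewrite -[leLHS]ger0_norm ?(ltW y0)// -sqrtr_sqr ler_wsqrtr//.
    exact/ltW/Num.Theory.truncnS_gt.
  by rewrite /y ler_pdivrMr ?divr_gt0// mulrC.
have head : \forall N \near U, \sum_(i < m.+1) `|alpha N i - l i| < e / 3.
  have : (fun N => \sum_(i < m.+1) `|alpha N i - l i|) @ U --> \sum_(i < m.+1) `|l i - l i|.
    apply: cvg_big => [|i _]; first exact: add_continuous.
    by apply: cvg_norm; apply: cvgB; [exact: lim | exact: cvg_cst].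
  rewrite big1 => [|i _]; last by rewrite subrr normr0.
  by move=> /cvgr_lt; apply; rewrite divr_gt0.
have large : \forall N \near U, (N0 <= N)%N by apply: ooU; exact: nbhs_infty_ge.
have [N [hN N0N]] := filter_ex (filterI head large).
exists N => // M.
apply: le_trans (_ : \sum_(i < M) ((if (i <= m)%N then `|alpha N i - l i| else 0) +
  ((if (m < i)%N then `|alpha N i| else 0) + (if (m < i)%N then `|l i| else 0))) <= _).
  apply: ler_sum => i _; case: ltnP => _; last by rewrite !addr0.
  by rewrite add0r ler_normB.
rewrite !big_split /=.
have t1 := coefs_tail_bound (wB N) M m0.
have t2 := coefs_tail_bound lB M m0.
have h : \sum_(i < M) (if (i <= m)%N then `|alpha N i - l i| else 0) <=
    \sum_(i < m.+1) `|alpha N i - l i|.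
  by apply: (@sum_truncated_le _ (fun i => `|alpha N i - l i|) m.+1 M).
lra.
Qed.

End Compactness.

(** * Cosine series and uniform approximation *)

Section CosineSeries.
Context {R : realType}.
Implicit Types (a l : nat -> R) (m n N M : nat) (x : R).

Definition cos_series l x : R := limn (fun M => cos_poly M l x).

Lemma cos_series_cvg l (B : R) x : (forall M, \sum_(i < M) `|l i| <= B) ->
  (fun M => cos_poly M l x) @ \oo --> cos_series l x.
Proof.
move=> lB; pose v i := l i * cosn i x.
have vE : (fun M => cos_poly M l x) = series v.
  by rewrite seriesEord.
have : cvgn (series v).
  apply: normed_cvg; apply: nondecreasing_is_cvgn.
    by apply: nondecreasing_series => i _ _; exact: normr_ge0.
  exists B => _ [M _ <-]; rewrite /normed_series_of seriesEord /=; apply: le_trans (lB M).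
  by apply: ler_sum => i _; rewrite normrM ler_piMr// normr_cosn_le1.
by rewrite /cos_series vE.
Qed.

Lemma cos_seriesN l x : cos_series l (- x) = cos_series l x.
Proof. by rewrite /cos_series; under eq_fun do rewrite cos_polyN. Qed.

Lemma cos_series_periodic l x : cos_series l (x + 2 * pi) = cos_series l x.
Proof. by rewrite /cos_series; under eq_fun do rewrite cos_poly_periodic. Qed.

Lemma normr_cos_series_le l (B : R) x : (forall M, \sum_(i < M) `|l i| <= B) ->
  `|cos_series l x| <= B.
Proof.
move=> lB; have := @cos_series_cvg l B x lB => /(cvg_norm).
apply: (@closed_cvg _ _ _ _ _ (fun y => y <= B)); first exact: closed_le.
by apply: nearW => M; apply: le_trans (normr_cos_poly_le _ _ _) (lB M).
Qed.

Lemma bm_cos_series l (B : R) : (forall M, \sum_(i < M) `|l i| <= B) ->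
  bounded_measurable (cos_series l).
Proof.
move=> lB; split; last by exists B => x; exact: normr_cos_series_le.
apply: (measurable_fun_cvg (h := fun M => cos_poly M l)) => [M|x _].
  by have [] := bm_cos_poly M l.
exact: cos_series_cvg lB.
Qed.

Lemma cos_poly_series_dist a l (B e : R) N x : (forall M, \sum_(i < M) `|l i| <= B) ->
  (forall M, \sum_(i < M) `|(if (i < N)%N then a i else 0) - l i| <= e) ->
  `|cos_poly N a x - cos_series l x| <= e.
Proof.
move=> lB ae; rewrite -[cos_poly N a x - _]opprK opprB normrN.
have : (fun M => `|cos_poly M l x - cos_poly N a x|) @ \oo -->
    `|cos_series l x - cos_poly N a x|.
  by apply: cvg_norm; apply: cvgB; [exact: cos_series_cvg lB | exact: cvg_cst].
apply: (@closed_cvg _ _ _ _ _ (fun y => y <= e)); first exact: closed_le.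
near=> M.
have NM : (N <= M)%N by near: M; exact: nbhs_infty_ge.
have -> : cos_poly N a x = \sum_(i < M) (if (i < N)%N then a i else 0) * cosn i x.
  rewrite /cos_poly -!(big_mkord xpredT (fun i => (if (i < N)%N then a i else 0) * cosn i x)).
  rewrite (@big_cat_nat _ _ _ N)//= [X in _ = _ + X]big_nat_cond [X in _ = _ + X]big1 ?addr0 => [|i].
    by rewrite big_mkord; apply: eq_bigr => i _; rewrite ltn_ord.
  by rewrite andbT => /andP[Ni _]; rewrite ltnNge Ni mul0r.
rewrite /cos_poly -sumrB; apply: le_trans (ler_norm_sum _ _ _) _.
apply: le_trans (ae M); apply: ler_sum => i _.
by rewrite -mulrBl normrM distrC ler_piMr// normr_cosn_le1.
Unshelve. all: by end_near. Qed.

End CosineSeries.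

Section UniformApproximation.
Context {R : realType}.
Implicit Types (u v : R -> R) (x y t : R) (phi : nat -> R).

(** Membership is stated for all large lengths so that sums need no padding. *)
Definition is_cos_poly u :=
  exists N a, forall M, (N <= M)%N -> forall x, u x = cos_poly M a x.

Lemma is_cos_poly_ext u v : u =1 v -> is_cos_poly u -> is_cos_poly v.
Proof. by move=> /funext ->. Qed.

Lemma is_cos_poly_cosn c n : is_cos_poly (fun x => c * cosn n x).
Proof.
exists n.+1, (fun i => if i == n then c else 0) => M nM x.
rewrite /cos_poly (bigD1 (Ordinal nM))//= eqxx big1 ?addr0// => i ni.
by rewrite ifN ?mul0r//; apply: contra ni => /eqP ni; apply/eqP/val_inj.
Qed.

Lemma is_cos_poly_add u v : is_cos_poly u -> is_cos_poly v ->
  is_cos_poly (fun x => u x + v x).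
Proof.
move=> [N [a ua]] [N' [a' va]]; exists (maxn N N'), (fun i => a i + a' i) => M.
rewrite geq_max => /andP[NM N'M] x; rewrite (ua M)// (va M)// -big_split /=.
by apply: eq_bigr => i _; rewrite mulrDl.
Qed.

Lemma is_cos_poly_cst c : is_cos_poly (fun=> c).
Proof.
by apply: is_cos_poly_ext (is_cos_poly_cosn c 0) => x; rewrite cosn0 mulr1.
Qed.

Lemma is_cos_poly_sum (I : Type) (r : seq I) (F : I -> R -> R) :
  (forall i, is_cos_poly (F i)) -> is_cos_poly (fun x => \sum_(i <- r) F i x).
Proof.
move=> cF; elim: r => [|i r IH].
  by apply: is_cos_poly_ext (is_cos_poly_cst 0) => x; rewrite big_nil.
by apply: is_cos_poly_ext (is_cos_poly_add (cF i) IH) => x; rewrite big_cons.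
Qed.

Lemma is_cos_poly_mul u v : is_cos_poly u -> is_cos_poly v ->
  is_cos_poly (fun x => u x * v x).
Proof.
move=> [N [a ua]] [N' [a' va]].
pose F (i : 'I_N) (j : 'I_N') x := (a i * cosn i x) * (a' j * cosn j x).
apply: (@is_cos_poly_ext (fun x => \sum_i \sum_j F i j x)) => [x|].
  rewrite (ua N)// (va N')// mulr_suml; apply: eq_bigr => i _.
  by rewrite mulr_sumr.
apply: is_cos_poly_sum => i; apply: is_cos_poly_sum => j.
apply: (@is_cos_poly_ext (fun x => a i * a' j / 2 * cosn (i + j) x +
    a i * a' j / 2 * cosn ((i - j) + (j - i)) x)) => [x|].
  rewrite /F; have -> : a i * cosn i x * (a' j * cosn j x) =
    a i * a' j * (cosn i x * cosn j x) by ring.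
  by rewrite cosnM; field.
by apply: is_cos_poly_add; exact: is_cos_poly_cosn.
Qed.

Lemma is_cos_poly_cos_poly N a : is_cos_poly (cos_poly N a).
Proof. by apply: is_cos_poly_sum => i; exact: is_cos_poly_cosn. Qed.

(** Mean of [phi] at the number of successes in [n] independent trials of success
    probability [y]: the Bernstein operator, by conditioning on the first trial. *)
Fixpoint bernstein y n phi : R :=
  if n is m.+1 then y * bernstein y m (phi \o S) + (1 - y) * bernstein y m phi
  else phi 0%N.

Lemma bernstein_le y n phi psi : 0 <= y <= 1 -> (forall k, phi k <= psi k) ->
  bernstein y n phi <= bernstein y n psi.
Proof.
move=> /andP[y0 y1]; elim: n phi psi => [|n IH] phi psi le_phi //=.
by rewrite lerD// ler_wpM2l ?subr_ge0// IH// => k; exact: le_phi.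
Qed.

Lemma bernstein_affine y n c d phi :
  bernstein y n (fun k => c + d * phi k) = c + d * bernstein y n phi.
Proof.
elim: n phi => [|n IH] phi //=.
rewrite IH -[X in y * bernstein y n X]/(fun k => c + d * (phi \o S) k) IH; ring.
Qed.

(** The second moment of the number of successes, shifted by [c] so that the
    induction goes through. *)
Lemma bernstein_variance y n c :
  bernstein y n (fun k => (k%:R + c) ^+ 2) = (n%:R * y + c) ^+ 2 + n%:R * (y * (1 - y)).
Proof.
elim: n c => [|n IH] c /=; first by rewrite !mul0r addr0.
rewrite IH.
have -> : (fun k => (k%:R + c) ^+ 2) \o S = (fun k : nat => (k%:R + (1 + c)) ^+ 2).
  by apply/funext => k /=; rewrite -natr1 addrA.
by rewrite IH -natr1; ring.
Qed.

Lemma is_cos_poly_bernstein u n phi : is_cos_poly u ->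
  is_cos_poly (fun x => bernstein (u x) n phi).
Proof.
move=> cu; elim: n phi => [|n IH] phi /=; first exact: is_cos_poly_cst.
apply: is_cos_poly_add; apply: is_cos_poly_mul => //; apply: is_cos_poly_add.
  exact: is_cos_poly_cst.
apply: (@is_cos_poly_ext (fun x => -1 * u x)) => [x|]; first by rewrite mulN1r.
by apply: is_cos_poly_mul => //; exact: is_cos_poly_cst.
Qed.

(** Chebyshev's argument for Bernstein polynomials of a Lipschitz function. *)
Lemma bernstein_lipschitz (f : R -> R) K y n : 0 <= K -> (0 < n)%N -> 0 <= y <= 1 ->
  (forall s t, `|f s - f t| <= K * `|s - t|) ->
  forall d, 0 < d ->
  `|bernstein y n (fun k => f (k%:R / n%:R)) - f y| <= K * (d + (d * n%:R)^-1).
Proof.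
move=> K0 n0 y01 lf d d0; have n_gt0 : 0 < n%:R :> R by rewrite ltr0n.
pose e k : R := K * (d + (k%:R + - (n%:R * y)) ^+ 2 / (d * n%:R ^+ 2)).
have fe k : `|f (k%:R / n%:R) - f y| <= e k.
  apply: le_trans (lf _ _) _; apply: ler_wpM2l => //.
  have -> : (k%:R + - (n%:R * y)) ^+ 2 / (d * n%:R ^+ 2) = (k%:R / n%:R - y) ^+ 2 / d.
    by field; rewrite !gt_eqF.
  rewrite -(real_normK (num_real (k%:R / n%:R - y))); set z := `|_|.
  rewrite -(ler_pM2r d0) mulrDl divfK ?gt_eqF//.
  have := sqr_ge0 (z - d / 2); have := sqr_ge0 d; have := sqr_ge0 z; nra.
have eE : bernstein y n e <= K * (d + (d * n%:R)^-1).
  have -> : e = (fun k => K * d + K / (d * n%:R ^+ 2) * (k%:R + - (n%:R * y)) ^+ 2).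
    by apply/funext => k; rewrite /e; ring.
  rewrite bernstein_affine bernstein_variance subrr expr0n add0r [leRHS]mulrDr lerD2l.
  have -> : K / (d * n%:R ^+ 2) * (n%:R * (y * (1 - y))) = K * (d * n%:R)^-1 * (y * (1 - y)).
    by field; rewrite !gt_eqF.
  apply: ler_piMr; first by rewrite mulr_ge0// invr_ge0 mulr_ge0// ltW.
  by move: y01 => /andP[y0 y1]; have := sqr_ge0 y; lra.
have upper : bernstein y n (fun k => f (k%:R / n%:R)) <= f y + 1 * bernstein y n e.
  rewrite -bernstein_affine; apply: bernstein_le => // k.
  by have := fe k; rewrite ler_norml mul1r => /andP[_]; lra.
have lower : f y + -1 * bernstein y n e <= bernstein y n (fun k => f (k%:R / n%:R)).
  rewrite -bernstein_affine; apply: bernstein_le => // k.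
  by have := fe k; rewrite ler_norml => /andP[+ _]; lra.
by apply: le_trans eE; rewrite ler_norml; apply/andP; split; lra.
Qed.

Lemma lipschitz_comp_approx (f : R -> R) K u B : 0 < B ->
  (forall s t, `|f s - f t| <= K * `|s - t|) ->
  is_cos_poly u -> (forall x, `|u x| <= B) ->
  forall e, 0 < e -> exists2 q, is_cos_poly q & forall x, `|f (u x) - q x| <= e.
Proof.
move=> B0 lf cu uB e e0.
have K0 : 0 <= K.
  by have := lf 1 0; rewrite subr0 normr1 mulr1; apply: le_trans; exact: normr_ge0.
pose g y := f (B * (2 * y - 1)).
have lg s t : `|g s - g t| <= K * (2 * B) * `|s - t|.
  apply: le_trans (lf _ _) _; rewrite -mulrA; apply: ler_wpM2l => //.
  have -> : B * (2 * s - 1) - B * (2 * t - 1) = 2 * B * (s - t) by ring.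
  by rewrite normrM ger0_norm// mulr_ge0// ltW.
pose KB := K * (2 * B).
have KB0 : 0 <= KB by rewrite !mulr_ge0// ltW.
pose d := e / (2 * (KB + 1)).
have KB1 : 0 < KB + 1 by apply: ltr_wpDl.
have d0 : 0 < d by rewrite divr_gt0// mulr_gt0.
pose n := (Num.truncn (d ^- 2)).+1.
pose h x := (u x / B + 1) / 2.
exists (fun x => bernstein (h x) n (fun k => g (k%:R / n%:R))).
  apply: is_cos_poly_bernstein.
  apply: (@is_cos_poly_ext (fun x => (2 * B)^-1 * u x + 2^-1)) => [x|].
    by rewrite /h; field; rewrite gt_eqF.
  apply: is_cos_poly_add; last exact: is_cos_poly_cst.
  by apply: is_cos_poly_mul => //; exact: is_cos_poly_cst.
move=> x.
have h01 : 0 <= h x <= 1.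
  have := uB x; rewrite ler_norml => /andP[u1 u2].
  have u3 : -1 <= u x / B by rewrite ler_pdivlMr// mulN1r.
  have u4 : u x / B <= 1 by rewrite ler_pdivrMr// mul1r.
  by rewrite /h; apply/andP; split; lra.
have -> : f (u x) = g (h x) by rewrite /g /h; congr f; field; rewrite gt_eqF.
have n0 : (0 < n)%N by [].
rewrite distrC; apply: le_trans (bernstein_lipschitz KB0 n0 h01 lg d0) _.
have dn : (d * n%:R)^-1 <= d.
  have n_gt0 : 0 < n%:R :> R by rewrite ltr0n.
  have : d ^- 2 <= n%:R by exact/ltW/Num.Theory.truncnS_gt.
  rewrite -(ler_pM2l (exprn_gt0 2 d0)) divff ?expf_neq0 ?gt_eqF// => H.
  have dn0 : 0 < d * n%:R by rewrite mulr_gt0.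
  by rewrite -(ler_pM2l dn0) divff ?gt_eqF// mulrAC -expr2.
have -> : e = (KB + 1) * (d + d) by rewrite /d; field; rewrite gt_eqF.
have X0 : 0 <= (d * n%:R)^-1 by rewrite invr_ge0 mulr_ge0// ltW.
by apply: ler_pM => //; lra.
Qed.

End UniformApproximation.

(** * Passing to the limit in the Galerkin solutions *)

Section GalerkinLimit.
Context {R : realType}.

Lemma le0_of_le_inv (C y : R) k0 :
  (forall k, (k0 <= k)%N -> y <= C * k.+1%:R^-1) -> y <= 0.
Proof.
move=> yC; rewrite leNgt; apply/negP => y0.
pose k := maxn k0 (Num.truncn (C / y)).
have := yC k (leq_maxl _ _); rewrite leNgt => /negP; apply.
rewrite ltr_pdivrMr ?ltr0n// mulrC -ltr_pdivrMr//.
apply: lt_le_trans (Num.Theory.truncnS_gt _) _.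
by rewrite ler_nat ltnS leq_maxr.
Qed.

Lemma eq0_of_norm_le_inv (C y : R) k0 :
  (forall k, (k0 <= k)%N -> `|y| <= C * k.+1%:R^-1) -> y = 0.
Proof.
move=> yC; apply/eqP; rewrite -normr_eq0 eq_le normr_ge0 andbT.
exact: le0_of_le_inv yC.
Qed.

Lemma torus_int_dist_le (h h' : R -> R) (e : R) :
  bounded_measurable h -> bounded_measurable h' ->
  (forall x, `|h x - h' x| <= e) -> `|torus_int h - torus_int h'| <= 2 * pi * e.
Proof.
move=> bh bh' hh'; rewrite -torus_int_sub//; apply: torus_int_norm_bound => //.
exact: bm_sub.
Qed.

Context (w : nat -> R) (f F : R -> R) (lam c K delta B : R) (a : nat -> nat -> R).
Context (lam1 : 1 < lam) (c0 : 0 < c) (delta0 : 0 < delta) (B0 : 0 <= B)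
  (w0 : w 0%N = 0) (w_ge0 : forall i, 0 <= w i)
  (f_lip : forall x y, `|f x - f y| <= K * `|x - y|)
  (f_zero : f 0 = 0)
  (F0 : F 0 = 0) (dF : forall x : R, is_derive x (1 : R) F (f x))
  (react_zero : forall t, react f lam t = 0 -> t = 0 \/ t = - c)
  (a_crit : forall n i, (i < n.+2)%N -> w i * cosn_mass i * a n i =
     torus_int (fun x => react f lam (cos_poly n.+2 (a n) x) * cosn i x))
  (a_energy : forall n, torus_int (fun x =>
     f (cos_poly n.+2 (a n) x) * cos_poly n.+2 (a n) x / 2 -
     F (cos_poly n.+2 (a n) x)) <= - delta)
  (a_off_well : forall n, ~ (forall x, cos_poly n.+2 (a n) x <= - (c / 2)))
  (a_sum : forall n, \sum_(i < n.+2) `|a n i| <= B)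
  (a_sqr : forall n, \sum_(i < n.+2) (i%:R * a n i) ^+ 2 <= B).

(** All integrals converge because the convergence is uniform.  A constant limit
    would be a zero of the reaction term.  It is not [0], where the energy
    vanishes, and it is not [- c], because the approximations would enter the
    well of [- c]. *)
Theorem galerkin_limit : exists l : nat -> R, let u := cos_series l in
  [/\ forall M, \sum_(i < M) `|l i| <= B + 1,
      forall x, `|u x| <= B,
      forall i, torus_int (fun x => u x * cosn i x) = cosn_mass i * l i,
      forall i, torus_int (fun x => u x * sin (i%:R * x)) = 0 &
      [/\ forall i, torus_int (fun x => react f lam (u x) * cosn i x) =
            cosn_mass i * (w i * l i),
          forall e : R, 0 < e -> exists2 q, is_cos_poly q &
            forall x, `|react f lam (u x) - q x| <= e &
          ~ torus_constant u]].
Proof.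
pose alpha n i := if (i < n.+2)%N then a n i else 0.
have alpha_sum n M : \sum_(i < M) `|alpha n i| <= B.
  apply: le_trans (a_sum n); apply: le_trans (@sum_truncated_le _ (fun i => `|a n i|) n.+2 M _) => //.
  by apply: ler_sum => i _; rewrite /alpha; case: ifP; rewrite ?normr0.
have alpha_sqr n M : \sum_(i < M) (i%:R * alpha n i) ^+ 2 <= B.
  apply: le_trans (a_sqr n).
  apply: le_trans (@sum_truncated_le _ (fun i => (i%:R * a n i) ^+ 2) n.+2 M _).
    apply: ler_sum => i _; rewrite /alpha; case: ifP => //.
    by rewrite mulr0 expr0n.
  by move=> i; exact: sqr_ge0.
have alpha_le n i : `|alpha n i| <= B.
  apply: le_trans (alpha_sum n i.+1); rewrite big_ord_recr /= lerDr.
  exact: sumr_ge0.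
have [l l_sqr l_lim] := coefs_compact alpha_le alpha_sqr.
have /choice[N N_lim] : forall k : nat, exists n, (k <= n)%N /\
    forall M, \sum_(i < M) `|alpha n i - l i| <= k.+1%:R^-1.
  move=> k; have [|n kn nl] := l_lim k.+1%:R^-1 k; last by exists n.
  by rewrite invr_gt0.
have l_sum M : \sum_(i < M) `|l i| <= B + 1.
  have [_ /(_ M)] := N_lim 0%N; rewrite invr1 => H.
  apply: le_trans (lerD (alpha_sum (N 0%N) M) H); rewrite -big_split /=.
  apply: ler_sum => i _.
  by rewrite -[l i in leLHS](subKr (alpha (N 0%N) i)) (le_trans (ler_normB _ _)).
exists l; set u := cos_series l.
pose v k := cos_poly (N k).+2 (a (N k)).
have vu k x : `|v k x - u x| <= k.+1%:R^-1.
  by apply: (cos_poly_series_dist x l_sum) => M; have [_] := N_lim k.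
have vB k x : `|v k x| <= B by apply: le_trans (normr_cos_poly_le _ _ _) (a_sum _).
have bu : bounded_measurable u := bm_cos_series l_sum.
have bv k : bounded_measurable (v k) by exact: bm_cos_poly.
have uB x : `|u x| <= B.
  rewrite -subr_le0; apply: (@le0_of_le_inv 1 _ 0%N) => k _; rewrite mul1r.
  have := ler_distD (v k x) (u x) 0; rewrite !subr0 => H.
  have := vu k x; rewrite distrC => H'.
  by rewrite lerBlDr; apply: le_trans H _; apply: lerD (vB k x).
have react_l := react_lip lam1 f_lip.
have cg := react_continuous lam1 f_lip.
have K0 : 0 <= K.
  by have := f_lip 1 0; rewrite subr0 normr1 mulr1; apply: le_trans; exact: normr_ge0.
have lK0 : 0 <= lam + K by have := lam1; lra.
have bgu : bounded_measurable (fun x => react f lam (u x)) by exact: (bm_comp cg bu).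
have bgv k : bounded_measurable (fun x => react f lam (v k x)) by exact: (bm_comp cg (bv k)).
have v_cos k i : (i < (N k).+2)%N ->
    torus_int (fun x => v k x * cosn i x) = cosn_mass i * a (N k) i.
  by move=> iN; rewrite torus_int_cos_poly_cosn iN.
have kN k i : (i <= k)%N -> (i < (N k).+2)%N.
  by move=> ik; have [kNk _] := N_lim k; rewrite ltnS leqW// (leq_trans ik).
have dist_cos i k : `|torus_int (fun x => v k x * cosn i x) -
    torus_int (fun x => u x * cosn i x)| <= 2 * pi * k.+1%:R^-1.
  apply: torus_int_dist_le; try by apply: bm_mul => //; exact: bm_cosn.
  move=> x; rewrite -mulrBl normrM; apply: le_trans (vu k x).
  by rewrite ler_piMr// normr_cosn_le1.
have u_cos i : torus_int (fun x => u x * cosn i x) = cosn_mass i * l i.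
  apply/eqP; rewrite -subr_eq0; apply/eqP.
  apply: (@eq0_of_norm_le_inv (2 * pi + cosn_mass i) _ i) => k ik.
  have m0 := ltW (cosn_mass_gt0 (R := R) i).
  have H1 := dist_cos i k; rewrite v_cos ?kN// in H1.
  have H2 : `|cosn_mass i * a (N k) i - cosn_mass i * l i| <= cosn_mass i * k.+1%:R^-1.
    rewrite -mulrBr normrM (ger0_norm m0); apply: ler_wpM2l => //.
    have [_ /(_ i.+1)] := N_lim k; apply: le_trans.
    rewrite big_ord_recr /= /alpha kN// lerDr; exact: sumr_ge0.
  have := ler_distD (cosn_mass i * a (N k) i) (torus_int (fun x => u x * cosn i x))
    (cosn_mass i * l i).
  rewrite distrC in H1; rewrite mulrDl => H; apply: le_trans H _; exact: lerD.
have u_sin i : torus_int (fun x => u x * sin (i%:R * x)) = 0.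
  apply: (@eq0_of_norm_le_inv (2 * pi) _ 0%N) => k _.
  have <- : `|torus_int (fun x => v k x * sin (i%:R * x)) -
      torus_int (fun x => u x * sin (i%:R * x))| = `|torus_int (fun x => u x * sin (i%:R * x))|.
    by rewrite torus_int_cos_poly_sin sub0r normrN.
  apply: torus_int_dist_le; try by apply: bm_mul => //; exact: bm_sin_scaled.
  move=> x; rewrite -mulrBl normrM; apply: le_trans (vu k x).
  by rewrite ler_piMr// sin_max.
have gvu k x : `|react f lam (v k x) - react f lam (u x)| <= (lam + K) * k.+1%:R^-1.
  by apply: le_trans (react_l _ _) _; rewrite ler_wpM2l.
have u_eq i : torus_int (fun x => react f lam (u x) * cosn i x) = cosn_mass i * (w i * l i).
  rewrite mulrCA -u_cos; apply/eqP; rewrite -subr_eq0; apply/eqP.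
  apply: (@eq0_of_norm_le_inv (2 * pi * (lam + K) + w i * (2 * pi)) _ i) => k ik.
  have H1 : `|torus_int (fun x => react f lam (v k x) * cosn i x) -
      torus_int (fun x => react f lam (u x) * cosn i x)| <= 2 * pi * ((lam + K) * k.+1%:R^-1).
    apply: torus_int_dist_le; try by apply: bm_mul => //; exact: bm_cosn.
    move=> x; rewrite -mulrBl normrM; apply: le_trans (gvu k x).
    by rewrite ler_piMr// normr_cosn_le1.
  rewrite -a_crit ?kN// -mulrA -v_cos ?kN// in H1.
  have H2 := ler_wpM2l (w_ge0 i) (dist_cos i k).
  rewrite -[in X in X * _ <= _](ger0_norm (w_ge0 i)) -normrM mulrBr in H2.
  have := ler_distD (w i * torus_int (fun x => v k x * cosn i x))
    (torus_int (fun x => react f lam (u x) * cosn i x))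
    (w i * torus_int (fun x => u x * cosn i x)).
  rewrite distrC in H1; move=> H; apply: le_trans H _.
  have -> : (2 * pi * (lam + K) + w i * (2 * pi)) * k.+1%:R^-1 =
    2 * pi * ((lam + K) * k.+1%:R^-1) + w i * (2 * pi * k.+1%:R^-1) by ring.
  exact: lerD.
have u_approx (e : R) : 0 < e -> exists2 q, is_cos_poly q &
    forall x, `|react f lam (u x) - q x| <= e.
  move=> e0; pose k := Num.truncn (2 * (lam + K) / e).
  have gk x : `|react f lam (v k x) - react f lam (u x)| <= e / 2.
    apply: le_trans (gvu k x) _; rewrite ler_pdivrMr ?ltr0n//.
    rewrite mulrC -ler_pdivrMr ?divr_gt0//.
    have -> : (lam + K) / (e / 2) = 2 * (lam + K) / e by field; rewrite gt_eqF.
    exact/ltW/Num.Theory.truncnS_gt.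
  have [||||q cq vq] := @lipschitz_comp_approx _ _ _ (v k) (B + 1) _ react_l _ _ (e / 2).
  - by rewrite ltr_wpDl.
  - exact: is_cos_poly_cos_poly.
  - by move=> x; apply: le_trans (vB k x) _; rewrite lerDl.
  - by rewrite divr_gt0.
  exists q => // x; have := ler_distD (react f lam (v k x)) (react f lam (u x)) (q x).
  move=> H; apply: le_trans H _; rewrite [leRHS]splitr; apply: lerD (vq x).
  by rewrite distrC; exact: gk.
split => //; split => // -[t ut].
have bf : continuous f by exact: lipschitz_continuous f_lip.
have cF := F_continuous dF.
have l0 i : (0 < i)%N -> l i = 0.
  move=> i0; have := u_cos i.
  rewrite (_ : torus_int _ = 0) => [/esym/eqP|].
    by rewrite mulf_eq0 gt_eqF ?cosn_mass_gt0//= => /eqP.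
  have -> : torus_int (fun x => u x * cosn i x) = torus_int (fun x => t * cosn i x).
    rewrite /torus_int /Rintegral; congr fine; apply: ae_eq_integral => //.
    - by apply/measurable_EFinP; have [] := bm_mul bu (bm_cosn i).
    - by apply/measurable_EFinP; have [] := bm_scale t (bm_cosn (R := R) i).
    - by case: ut => A [mA A0 sA]; exists A; split => // x /= nx; apply: sA => /= uxt;
        apply: nx => _; rewrite /= uxt.
  by rewrite torus_int_scale ?torus_int_cosn ?gtn_eqF ?mulr0//; exact: bm_cosn.
have lt0 : l 0%N = t.
  have := u_cos 0%N; under eq_torus_int do rewrite cosn0 mulr1.
  rewrite (torus_int_ae_cst (h := id) bu ut) /cosn_mass /= => /eqP.
  by rewrite -subr_eq0 -mulrBr mulf_eq0 gt_eqF ?mulr_gt0 ?pi_gt0//= subr_eq0 => /eqP.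
have u_t x : u x = t.
  apply/eqP; rewrite -subr_eq0; apply/eqP.
  have := @cos_series_cvg R l (B + 1) x l_sum.
  have -> : u x = t.
    rewrite /u /cos_series; apply: cvg_lim => //.
    apply: cvg_near_cst; near=> M; have M0 : (0 < M)%N by near: M; exact: nbhs_infty_gt.
    rewrite /cos_poly -(prednK M0) big_ord_recl /= cosn0 mulr1 lt0.
    by rewrite big1 ?addr0// => i _; rewrite l0 ?mul0r.
  by rewrite subrr.
have react_t : react f lam t = 0.
  have := u_eq 0%N; under eq_torus_int do rewrite cosn0 mulr1 u_t.
  rewrite torus_int_cst w0 mul0r mulr0 => /eqP.
  by rewrite mulf_eq0 gt_eqF ?mulr_gt0 ?pi_gt0//= => /eqP.
have vt k x : `|v k x - t| <= k.+1%:R^-1 by rewrite -(u_t x).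
have [t0|tc] := react_zero react_t; last first.
  pose k := Num.truncn (2 / c).
  apply: (@a_off_well (N k)) => x; have := vt k x; rewrite tc opprK.
  have kc : k.+1%:R^-1 <= c / 2.
    rewrite -[c / 2]invf_div lef_pV2 ?posrE ?ltr0n ?divr_gt0//.
    exact/ltW/Num.Theory.truncnS_gt.
  move=> /(le_trans (ler_norm _)) /le_trans /(_ kc); rewrite -[X in _ -> X <= _]/(v k x).
  by move: (v k x) => y; lra.
have d0 : delta <= 0; last by have := delta0; rewrite ltNge d0.
apply: (@le0_of_le_inv (2 * pi * K) _ 0%N) => k _.
pose h x := f (v k x) * v k x / 2 - F (v k x).
have bh : bounded_measurable h.
  apply: bm_sub; last exact: (bm_comp cF (bv k)).
  apply: bm_mul; last exact: bm_cst.
  by apply: bm_mul => //; exact: (bm_comp bf (bv k)).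
have hk x : `|h x| <= K * k.+1%:R^-1.
  have := vt k x; rewrite t0 subr0 /h; set y := v k x => yk.
  have fy : `|f y| <= K * `|y| by have := f_lip y 0; rewrite f_zero !subr0.
  have Fy : `|F y| <= K / 2 * y ^+ 2.
    by have := first_order_expansion dF f_lip 0 y; rewrite add0r F0 f_zero mul0r !subr0.
  apply: le_trans (ler_normB _ _) _.
  have fyy : `|f y * y / 2| <= K / 2 * y ^+ 2.
    rewrite !normrM [X in _ * _ * X]ger0_norm// -(real_normK (num_real y)).
    by have := ler_wpM2r (normr_ge0 y) fy; lra.
  have yy : y ^+ 2 <= k.+1%:R^-1.
    rewrite -(real_normK (num_real y)) expr2; apply: le_trans (yk); rewrite ler_piMl//.
    by apply: le_trans yk _; rewrite invf_le1 ?ler1n ?ltr0n.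
  apply: le_trans (lerD fyy Fy) _; rewrite -mulrDl -splitr.
  exact: ler_wpM2l.
have := torus_int_norm_bound bh hk; rewrite ler_norml => /andP[H _].
rewrite -lerN2 -mulrA; apply: le_trans H _; exact: a_energy.
Unshelve. all: by end_near. Qed.

End GalerkinLimit.

(** * The solution with the power nonlinearity *)

Section PowerNonlinearity.
Context {R : realType}.

Lemma powR_inv_root (q y : R) : 1 <= q -> 0 <= y -> (y `^ q^-1) `^ q = y.
Proof.
by move=> q1 y0; rewrite -powRrM mulVf ?powRr1// gt_eqF//; lra.
Qed.

Lemma powR_root_inv (q y : R) : 1 <= q -> 0 <= y -> (y `^ q) `^ q^-1 = y.
Proof.
by move=> q1 y0; rewrite -powRrM mulfV ?powRr1// gt_eqF//; lra.
Qed.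

Lemma trunc_power_zeros (q M c t : R) : 1 <= q -> 0 < c -> c < M ->
  c `^ q * t + trunc_power q M t = 0 -> t = 0 \/ t = - c.
Proof.
move=> q1 c0 cM E.
have cq0 : 0 < c `^ q by rewrite powR_gt0.
have t0 : t <= 0.
  rewrite leNgt; apply/negP => t0; have := mulr_gt0 cq0 t0.
  have := trunc_power_ge0 q M t; lra.
have [->|tn0] := eqVneq t 0; first by left.
right; move: E; rewrite /trunc_power ler0_norm// => E.
have {}E : Num.min (- t) M `^ q = c `^ q.
  have : (Num.min (- t) M `^ q - c `^ q) * - t = 0 by lra.
  by move/eqP; rewrite mulf_eq0 oppr_eq0 (negbTE tn0) orbF subr_eq0 => /eqP.
have m0 : 0 <= Num.min (- t) M by rewrite le_min oppr_ge0 t0 (le_trans (ltW c0) (ltW cM)).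
have := congr1 (fun y => y `^ q^-1) E; rewrite !powR_root_inv ?(ltW c0)//.
case: (leP (- t) M) => _ H; first by rewrite -H opprK.
by move: cM; rewrite H ltxx.
Qed.

Definition nonlinear_rhs (p lam : R) (u : R -> R) x : R := lam * u x + `|u x| `^ p.

(** The bound [B] does not depend on the truncation level [M], which is therefore
    chosen afterwards, so large that the solution never sees the truncation. *)
Theorem nonconstant_solution (s p lam : R) : 1 / 2 <= s -> 2 <= p -> 1 < lam ->
  exists (l : nat -> R) (B : R), let u := cos_series l in
  [/\ forall M, \sum_(i < M) `|l i| <= B,
      bounded_measurable (nonlinear_rhs p lam u),
      forall i, torus_int (fun x => u x * cosn i x) = cosn_mass i * l i,
      forall i, torus_int (fun x => u x * sin (i%:R * x)) = 0 &
      [/\ forall i, torus_int (fun x => nonlinear_rhs p lam u x * cosn i x) =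
            cosn_mass i * (i%:R `^ (2 * s) * l i),
          forall e : R, 0 < e -> exists2 q, is_cos_poly q &
            forall x, `|nonlinear_rhs p lam u x - q x| <= e &
          ~ torus_constant u]].
Proof.
move=> hs hp lam1.
have p1 : 1 <= p by lra.
have [q q1 qp] : exists2 q : R, 1 <= q & q + 1 = p by exists (p - 1); [lra | ring].
have lam0 : 0 < lam by lra.
have s2 : 2 * s != 0 by rewrite gt_eqF//; lra.
have s2_ge1 : 1 <= 2 * s by lra.
have lam2 : 0 <= 2 * lam by lra.
have [c c0 lamE] : exists2 c : R, 0 < c & lam = c `^ q.
  by exists (lam `^ q^-1); rewrite ?powR_gt0// powR_inv_root// ltW.
have eta0 : 0 < (lam - 1) / 2 by lra.
have [r0 r00 etaE] : exists2 r0 : R, 0 < r0 & r0 `^ q = (lam - 1) / 2.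
  by exists (((lam - 1) / 2) `^ q^-1); rewrite ?powR_gt0// powR_inv_root// ltW.
have [r [r_gt0 rc rr0]] : exists r : R, [/\ 0 < r, r <= c & r <= r0].
  by exists (Num.min c r0); rewrite lt_min c0 r00 !ge_min !lexx orbT.
have [m m0 mE] : exists2 m : R, 0 <= m & m `^ q = 2 * lam.
  by exists ((2 * lam) `^ q^-1); rewrite ?powR_ge0// powR_inv_root.
have C00 : 0 <= 2 * lam * m by rewrite mulr_ge0.
have [B apriori] := a_priori_bound lam0 p1 C00.
have [M [cM2 cM mM BM]] : exists M : R, [/\ 2 * c <= M, c < M, m <= M & B <= M].
  exists (2 * c + m + `|B|); have := ler_norm B; have := normr_ge0 B.
  by move=> B1 B2; split; lra.
have M0 : 0 < M by apply: lt_trans cM.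
pose f := trunc_power q M.
have f_lip := trunc_power_lipschitz q1 M0.
have cf : continuous f by exact: lipschitz_continuous f_lip.
have [F [F0 dF]] := continuous_antiderivative cf.
have f_small t : `|t| <= r -> f t <= (lam - 1) / 2 * `|t|.
  move=> tr; have tr0 : `|t| <= r0 by apply: le_trans tr _.
  by have := trunc_power_small q1 M0 tr0; rewrite etaE.
have f_sup t : 2 * lam * `|t| <= f t + 2 * lam * m.
  by have := trunc_power_superlinear q1 t m0 mM; rewrite mE.
have f_c : f (- c) = lam * c.
  rewrite /f (trunc_power_eq q1) normrN gtr0_norm ?(ltW cM)//.
  by rewrite powRD ?powRr1 ?(ltW c0) -?lamE// (gt_eqF c0) implybT.
pose w (i : nat) : R := i%:R `^ (2 * s).
have w0 : w 0%N = 0 by rewrite /w powR0.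
have w1 : w 1%N = 1 by rewrite /w powR1.
have w_ge0 i : 0 <= w i by exact: powR_ge0.
have iw i : i%:R <= w i.
  case: i => [|i]; first by rewrite w0.
  by apply: le1r_powR; rewrite ?ler1n.
have react0 := reaction_le0 q1 M0 lamE.
have reacts := reaction_sign q1 M0 c0 cM2 lamE.
have gal := galerkin_mountain_pass w0 w1 w_ge0 lam1 c0 r_gt0 rc (@trunc_power_ge0 _ q M)
  f_lip F0 dF f_small f_sup f_c react0 reacts.
have [a a_prop] := choice gal.
have delta0 : 0 < (lam - 1) * pi / 8 * r ^+ 2.
  by rewrite !mulr_gt0 ?pi_gt0 ?exprn_gt0 ?invr_gt0// subr_gt0.
have a_crit n := let: And3 h _ _ := a_prop n in h.
have a_en n := let: And3 _ h _ := a_prop n in h.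
have a_off n := let: And3 _ _ h := a_prop n in h.
have a_bd n := apriori w f n.+2 (a n) iw w0 isT cf (@trunc_power_ge0 _ q M) _ f_sup (a_crit n).
have f_le t : f t <= `|t| `^ p by rewrite -qp trunc_power_le.
have {}a_bd := a_bd f_le.
have B0 : 0 <= B by apply: le_trans (a_bd 0%N).1; apply: sumr_ge0.
have f_zero : f 0 = 0 by rewrite /f /trunc_power normr0 mulr0.
have zeros t : react f lam t = 0 -> t = 0 \/ t = - c.
  by rewrite /react lamE; exact: trunc_power_zeros.
have [l] := galerkin_limit lam1 c0 delta0 B0 w0 w_ge0 f_lip f_zero F0 dF zeros
  a_crit a_en a_off (fun n => (a_bd n).1) (fun n => (a_bd n).2).
set u := cos_series l => -[l_sum uB u_cos u_sin [u_eq u_approx u_nc]].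
have rhsE x : react f lam (u x) = nonlinear_rhs p lam u x.
  rewrite /react /nonlinear_rhs /f (trunc_power_eq q1) ?qp//.
  exact: le_trans (uB x) BM.
have {}rhsE : (fun x => react f lam (u x)) = nonlinear_rhs p lam u by apply/funext.
exists l, (B + 1); split => //.
- rewrite -rhsE; apply: (bm_comp (react_continuous lam1 f_lip)).
  exact: bm_cos_series l_sum.
split => // [i|e e0].
- by rewrite -[X in torus_int X]/(fun x => nonlinear_rhs p lam u x * cosn i x) -rhsE.
- by have [Q cQ uQ] := u_approx e e0; exists Q; rewrite // -rhsE.
Qed.

End PowerNonlinearity.

(** * Fourier coefficients and the fractional Laplacian *)

Section FourierCoefficients.
Context {R : realType}.
Local Open Scope complex_scope.
Implicit Types (u g : R -> R).

Lemma bm_Lfun2 g : bounded_measurable g -> g \in Lfun (torus_measure R) 2%:E.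
Proof.
move=> bg; rewrite inE /=; apply/andP; split; rewrite inE //=; first by case: bg.
rewrite /finite_norm unlock poweR_lty//.
under eq_integral => x _ /= do rewrite powR_mulrn//.
apply/integrable_lty => //; apply: bm_integrable.
by apply: bm_sqr; exact: bm_norm.
Qed.

Lemma cosn_absz (n : int) (x : R) : cos (n%:~R * x) = cosn `|n|%N x.
Proof.
case: n => n; first by rewrite /cosn -pmulrn.
by rewrite NegzE /cosn abszN /= mulrNz mulNr cosN -pmulrn.
Qed.

Lemma fourier_coef_even u (l : nat -> R) : bounded_measurable u ->
  (forall i, torus_int (fun x => u x * cosn i x) = cosn_mass i * l i) ->
  (forall i, torus_int (fun x => u x * sin (i%:R * x)) = 0) ->
  forall n : int,
  fourier_coef u n = (cosn_mass `|n|%N / (2 * pi) * l `|n|%N)%:C.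
Proof.
move=> bu u_cos u_sin n; rewrite /fourier_coef.
have -> : Rintegral (torus_measure R) setT
    (fun x => complex.Re ((u x)%:C * cexpi (- (n%:~R * x)))) = cosn_mass `|n|%N * l `|n|%N.
  rewrite -u_cos; apply: eq_torus_int => x /=.
  by rewrite cosN cosn_absz mul0r subr0.
have -> : Rintegral (torus_measure R) setT
    (fun x => complex.Im ((u x)%:C * cexpi (- (n%:~R * x)))) = 0.
  transitivity (torus_int (fun x => (- sgz n)%:~R * (u x * sin (`|n|%:R * x)))).
    apply: eq_torus_int => x /=; rewrite mul0r addr0 sinN.
    case: n => [[|n]|n].
    - by rewrite /= !mul0r sin0 oppr0 mulr0.
    - by rewrite /= mulN1r mulrN -pmulrn.
    - by rewrite NegzE abszN /= mulrNz mulNr sinN opprK -pmulrn mul1r.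
  by rewrite torus_int_scale ?u_sin ?mulr0//; apply: bm_mul => //; exact: bm_sin_scaled.
rewrite -[_ +i* 0]/((cosn_mass `|n|%N * l `|n|%N)%:C) -rmorphM /=.
by congr (_%:C); ring.
Qed.

Lemma normc_real (y : R) : ComplexField.Normc.normc y%:C = `|y|.
Proof. by rewrite /ComplexField.Normc.normc /= expr0n addr0 sqrtr_sqr. Qed.

Lemma sum_symmetric_range (V : zmodType) (T : int -> V) N :
  \sum_(k < N.*2.+1) T (k%:Z - N%:Z)%R = T 0 + \sum_(i < N) (T i.+1%:Z + T (- i.+1%:Z)).
Proof.
elim: N => [|N IH]; first by rewrite big_ord_recr !big_ord0 /= subrr addr0 add0r.
rewrite [in RHS]big_ord_recr /= addrA -IH doubleS big_ord_recl big_ord_recr /=.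
rewrite [LHS]addrC -[LHS]addrA; congr (_ + (_ + _)).
- apply: eq_bigr => k _; congr T; rewrite /bump /=; lia.
- congr T; rewrite /bump /=; lia.
- congr T; lia.
Qed.

Context (s p lam : R) (l : nat -> R) (B : R) (s0 : 0 < s) (l_sum : forall M, \sum_(i < M) `|l i| <= B).
Let u := cos_series l.
Let g := nonlinear_rhs p lam u.
Context (bg : bounded_measurable g)
  (u_cos : forall i, torus_int (fun x => u x * cosn i x) = cosn_mass i * l i)
  (u_sin : forall i, torus_int (fun x => u x * sin (i%:R * x)) = 0)
  (u_eq : forall i, torus_int (fun x => g x * cosn i x) = cosn_mass i * (i%:R `^ (2 * s) * l i))
  (g_approx : forall e : R, 0 < e -> exists2 q, is_cos_poly q &
     forall x, `|g x - q x| <= e).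

Let bu : bounded_measurable u. Proof. exact: bm_cos_series l_sum. Qed.

Let wl i : R := i%:R `^ (2 * s) * l i.

(** The modes [n] and [- n] have equal real coefficients and combine to a cosine. *)
Lemma frac_laplacian_psum_cos N x :
  frac_laplacian_psum s u N x = (cos_poly N.+1 wl x)%:C.
Proof.
have pi0 := pi_gt0 R.
have fc := fourier_coef_even bu u_cos u_sin.
rewrite /frac_laplacian_psum.
pose T (n : int) := (`|n%:~R| `^ (2 * s))%:C * fourier_coef u n * cexpi (n%:~R * x).
rewrite (sum_symmetric_range T) /cos_poly big_ord_recl rmorphD rmorph_sum /=.
have z0 : (0 : R) `^ (2 * s) = 0 by rewrite powR0// gt_eqF// mulr_gt0.
have w0 : wl 0 = 0 by rewrite /wl z0 mul0r.
have -> : T 0 = 0 by rewrite /T normr0 z0 !mul0r.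
rewrite w0 mul0r; congr (_ + _); apply: eq_bigr => i _.
rewrite /T !fc abszN /= /cosn_mass /=.
have -> : `|(- i.+1%:Z)%:~R| = i.+1%:R :> R by rewrite mulrNz normrN -pmulrn normr_nat.
rewrite -pmulrn normr_nat.
have -> : cexpi ((- i.+1%:Z)%:~R * x) = cos (i.+1%:R * x) +i* (- sin (i.+1%:R * x)).
  by rewrite /cexpi mulrNz mulNr -pmulrn cosN sinN.
rewrite -!rmorphM /= /cexpi /bump /= add1n /wl /cosn; apply/eqP; rewrite eq_complex /=.
have -> : pi / (2 * pi) = 2^-1 :> R by rewrite invfM mulrCA mulfV ?mulr1// gt_eqF.
by apply/andP; split; apply/eqP; field.
Qed.

(** By the equation, the weighted coefficients of [u] are those of the bounded
    function [g], so the Sobolev norm is finite by Bessel's inequality. *)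
Lemma even_sobolev_solution : even_sobolev (2 * s) u.
Proof.
have pi0 := pi_gt0 R.
split; [exact: cos_series_periodic | exact: cos_seriesN | exact: bm_Lfun2 |].
pose t (i : nat) : \bar R := (i%:R `^ (2 * (2 * s)) *
  ComplexField.Normc.normc (cosn_mass i / (2 * pi) * l i)%:C ^+ 2)%:E.
have t0 i : (0 <= t i)%E by rewrite lee_fin mulr_ge0 ?powR_ge0 ?sqr_ge0.
have tn (n : int) : (`|n%:~R| `^ (2 * (2 * s)) *
    ComplexField.Normc.normc (fourier_coef u n) ^+ 2)%:E = t `|n|%N.
  rewrite (fourier_coef_even bu u_cos u_sin) /t.
  by rewrite -intr_norm -abszE -pmulrn.
under eq_esum do rewrite tn.
have tfin : (\sum_(i <oo) t i < +oo)%E.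
  apply: (@le_lt_trans _ _ (torus_int (fun x => g x ^+ 2))%:E); last exact: ltry.
  apply: lime_le; first by apply: is_cvg_nneseries => i _ _; exact: t0.
  apply: nearW => N; rewrite big_mkord sumEFin lee_fin.
  apply: le_trans (bessel N bg u_eq); apply: ler_sum => i _.
  rewrite normc_real real_normK ?num_real//.
  have -> : (i%:R : R) `^ (2 * (2 * s)) = (i%:R `^ (2 * s)) ^+ 2.
    by rewrite -powR_mulrn ?powR_ge0// -powRrM; congr (_ `^ _); ring.
  have m0 := cosn_mass_gt0 (R := R) i; have m2 := cosn_mass_le (R := R) i.
  have -> : (i%:R `^ (2 * s)) ^+ 2 * (cosn_mass i / (2 * pi) * l i) ^+ 2 =
    (cosn_mass i / (2 * pi)) ^+ 2 * wl i ^+ 2 by rewrite /wl; ring.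
  apply: ler_wpM2r; first exact: sqr_ge0.
  have pi2 : 0 < 2 * pi :> R by rewrite mulr_gt0.
  have r1 : cosn_mass i / (2 * pi) <= 1 :> R by rewrite ler_pdivrMr// mul1r.
  have r0 : 0 <= cosn_mass i / (2 * pi) :> R by apply: divr_ge0; exact: ltW.
  apply: (@le_trans _ _ 1); first by rewrite expr_le1.
  apply: le_trans (cosn_mass_ge i); have := pi_ge2 R; lra.
have tneg : (\sum_(i <oo) t i.+1 < +oo)%E.
  apply: le_lt_trans tfin; rewrite [leRHS]nneseries_recl//.
  have <- : (\sum_(i <oo) t (i + 1)%N)%E = (\sum_(i <oo) t i.+1)%E.
    by apply: eq_eseriesr => i _; rewrite addn1.
  by rewrite nneseries_addn// leeDr.
rewrite (esumID (range Posz)); last by move=> n _; exact: t0.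
have -> : [set: int] `&` range Posz = [set Posz i | i in setT] by rewrite setTI.
have -> : [set: int] `&` ~` range Posz = [set Negz i | i in setT].
  rewrite setTI; apply/seteqP; split => [[i|i]|_ [i _ <-]] /=.
  - by move=> H; case: H; exists i.
  - by move=> _; exists i.
  - by move=> [j _].
rewrite !esum_set_image//; first last.
- by move=> i j _ _ [].
- by move=> i j _ _ [].
under [X in (X + _)%E]eq_eseriesl do rewrite in_setT.
under [X in (_ + X)%E]eq_eseriesl do rewrite in_setT.
exact: lte_add_pinfty.
Qed.

(** The partial sums are the Fourier partial sums of [g], hence at least as close
    to [g] in [L^2] as the cosine polynomials that approximate it uniformly. *)
Lemma is_frac_laplacian_solution : is_frac_laplacian s u g.
Proof.
have pi0 := pi_gt0 R.
split; first exact: bm_Lfun2.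
have bS N : bounded_measurable (fun x => (g x - cos_poly N.+1 wl x) ^+ 2).
  by apply: bm_sqr; apply: bm_sub => //; exact: bm_cos_poly.
have E N : (\int[torus_measure R]_x (ComplexField.Normc.normc
    (frac_laplacian_psum s u N x - (g x)%:C) ^+ 2)%:E)%E =
    (torus_int (fun x => (g x - cos_poly N.+1 wl x) ^+ 2))%:E.
  rewrite /torus_int /Rintegral fineK; last by apply: integrable_fin_num => //; exact: bm_integrable.
  apply: eq_integral => x _; rewrite frac_laplacian_psum_cos -rmorphB normc_real.
  by rewrite real_normK ?num_real// -[in RHS]opprB sqrrN.
under eq_fun do rewrite E.
apply: cvg_EFin; first by near=> N.
apply/cvgrPdist_le => e e0; rewrite /=.
have [d d0 de] : exists2 d : R, 0 < d & 2 * pi * d ^+ 2 <= e.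
  exists (Num.sqrt (e / (2 * pi))); first by rewrite sqrtr_gt0 divr_gt0// mulr_gt0.
  rewrite sqr_sqrtr; last by rewrite divr_ge0 ?ltW// mulr_gt0.
  by rewrite mulrC divfK// gt_eqF// mulr_gt0.
have [q [N0 [a qa]] gq] := g_approx d0.
near=> N.
have NN : (N0 <= N.+1)%N by apply: leqW; near: N; exact: nbhs_infty_ge.
rewrite sub0r normrN ger0_norm; last by apply: torus_int_ge0 => x; exact: sqr_ge0.
apply: le_trans de; apply: le_trans (_ : torus_int (fun x => (g x - cos_poly N.+1 a x) ^+ 2) <= _).
  rewrite !(cos_poly_sqr_distance _ _ bg u_eq) lerD2l.
  rewrite big1 => [|i _]; last by rewrite subrr expr0n mulr0.
  by apply: sumr_ge0 => i _; rewrite mulr_ge0 ?sqr_ge0// ltW// cosn_mass_gt0.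
apply: le_trans (ler_norm _) _; apply: torus_int_norm_bound => [|x].
  by apply: bm_sqr; apply: bm_sub => //; exact: bm_cos_poly.
rewrite normrX lerXn2r ?nnegrE ?(ltW d0)//.
by rewrite -(qa N.+1 NN); exact: gq.
Unshelve. all: by end_near. Qed.

End FourierCoefficients.

Theorem theorem1p2 (R : realType) (s p lam : R)
  (hs : 1 / 2 <= s) (hp2 : 2 <= p) (hp : p < 4 * s + 1)
  (hlam : (\bigcup_(k in [set k : nat | (0 < k)%N])
             `]k%:R `^ (2 * s), k.+1%:R `^ (2 * s)[%classic) lam) :
  exists u : R -> R, even_solution s p lam u /\ ~ torus_constant u.
Proof.
have s0 : 0 < s by lra.
have lam1 : 1 < lam.
  case: hlam => k /= k0; rewrite in_itv /= => /andP[klam _]; apply: le_lt_trans klam.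
  rewrite -[leLHS](powRr0 k%:R); apply: ler_powR; [by rewrite ler1n | lra].
have [l [B [l_sum bg u_cos u_sin [u_eq g_approx u_nc]]]] :=
  nonconstant_solution hs hp2 lam1.
exists (cos_series l); split => //; split.
  exact: (even_sobolev_solution l_sum bg u_cos u_sin u_eq).
exists (nonlinear_rhs p lam (cos_series l)); last by apply: aeW.
exact: (is_frac_laplacian_solution s0 l_sum bg u_cos u_sin u_eq g_approx).
Qed.
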